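(* There exist a stationary random graph $(G,\rho)$ of almost sure polynomial growth and an infinite strictly increasing (deterministic) sequence of times $\{t_n\}_{n\ge1}$ of positive integers such that $$\lim_{n\to\infty}\Pr\left(\mathbb{E}\left[d_G(X_0,X_{t_n})^2\mid (G,\rho)\right]\ge t_n(\log t_n)^{0.9}\right)=1 .$$
   Context: A random rooted graph $(G,\rho)$ is a random variable with values in the (isomorphism classes of) rooted graphs; $G$ is assumed locally finite and almost surely connected. $V_G$ is the vertex set, $d_G$ the graph metric, and $B^G_x(r)=\{y\in V_G: d_G(x,y)\le r\}$. Conditioned on $(G,\rho)$, $\{X_n\}_{n\ge 0}$ is the simple random walk on $G$ with $X_0=\rho$; $\mathbb{E}[\cdot\mid(G,\rho)]$ averages over the walk only, and the outer probability is over $(G,\rho)$. $(G,\rho)$ is stationary if $(G,X_0)$ and $(G,X_1)$ have the same law. Almost sure polynomial growth means: there are (deterministic) constants $c,d>0$ such that almost surely, $|B^G_x(r)|\le c r^d$ for all $x\in V_G$ and all $r\ge 1$. *)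

(* Defs.v *)
From HB Require Import structures.
From mathcomp Require Import all_boot all_order all_algebra.
From mathcomp Require Import finmap.
From mathcomp Require Import all_classical all_reals all_analysis.
Set Implicit Arguments.
Unset Strict Implicit.
Unset Printing Implicit Defensive.
Import Order.TTheory GRing.Theory Num.Theory.
Import numFieldNormedType.Exports.
Local Open Scope classical_set_scope.
Local Open Scope ring_scope.

(* Undirected, simple, locally finite graphs. A connected locally finite graph
   is countable, so up to isomorphism its vertex set is a set of naturals. *)
Record lfgraph := LFGraph {
  vset : set nat ;
  adj : rel vset ;
  adj_sym : symmetric adj ;
  adj_irr : irreflexive adj ;
  adj_lf : forall x : vset, finite_set [set y | adj x y]
}.

Definition vertex (G : lfgraph) : choiceType := vset G.

Definition nbrs (G : lfgraph) (x : vertex G) : set (vertex G) :=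
  [set y | adj x y].

Definition degree (G : lfgraph) (x : vertex G) : nat := #|` fset_set (nbrs x)|.

Fixpoint walk_of_length (G : lfgraph) (n : nat) (x y : vertex G) : Prop :=
  if n is m.+1 then exists2 z, adj x z & walk_of_length m z y else x = y.

Definition reachable (G : lfgraph) (x y : vertex G) : Prop :=
  exists n, walk_of_length n x y.

Definition connected_graph (G : lfgraph) : Prop :=
  forall x y : vertex G, reachable x y.

(* Junk value 0 when y is not reachable from x; gball therefore asks for
   reachability separately. *)
Definition gdist (G : lfgraph) (x y : vertex G) : nat :=
  xget 0%N [set n | walk_of_length n x y /\
                    forall m, walk_of_length m x y -> (n <= m)%N].

Definition gball (R : numDomainType) (G : lfgraph) (x : vertex G) (r : R) :
    set (vertex G) :=
  [set y | reachable x y /\ (gdist x y)%:R <= r].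

(* Transition probabilities of the simple random walk; at an isolated vertex
   (a one-vertex component) the walk stays put. *)
Definition srw_step (R : realType) (G : lfgraph) (x y : vertex G) : R :=
  if degree x == 0%N then (x == y)%:R
  else if adj x y then (degree x)%:R^-1 else 0.

(* srw_law R x n y is the probability that X_n = y when X_0 = x. The sums below
   have finite support because G is locally finite. *)
Fixpoint srw_law (R : realType) (G : lfgraph) (x : vertex G) (n : nat)
    (y : vertex G) : R :=
  if n is m.+1 then
    \sum_(z \in [set: vertex G]) srw_law R x m z * srw_step R z y
  else (x == y)%:R.

(* The expectation of f X_n over the walk started at x. *)
Definition srw_expect (R : realType) (G : lfgraph) (x : vertex G) (n : nat)
    (f : vertex G -> R) : R :=
  \sum_(y \in [set: vertex G]) srw_law R x n y * f y.

Record rooted_graph := Rooted { graph_of :> lfgraph ; root_of : vertex graph_of }.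

(* The balls of radius r around the roots, as rooted induced subgraphs, are
   isomorphic. *)
Definition ball_iso (r : nat) (g h : rooted_graph) : Prop :=
  exists f : vertex g -> vertex h,
    [/\ set_bij (gball (root_of g) r%:Z) (gball (root_of h) r%:Z) f,
        f (root_of g) = root_of h
      & forall x y, gball (root_of g) r%:Z x -> gball (root_of g) r%:Z y ->
          adj (f x) (f y) = adj x y].

(* The Borel sigma-algebra of the local topology on isomorphism classes of
   rooted graphs, pulled back to representatives: it is generated by the events
   "the r-ball around the root is isomorphic to that of h". Its members are
   invariant under rooted isomorphism, so random variables valued in isomorphism
   classes amount to measurable functions into rooted_space. *)
Definition local_events : set (set rooted_graph) :=
  [set A | exists r h, A = [set g | ball_iso r g h]].

(* g_sigma_algebraType needs a pointed type; the point itself is irrelevant. *)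
Lemma edgeless_lf (V : set nat) (x : V) : finite_set [set y : V | false].
Proof. by rewrite (_ : [set _ | _] = set0) //; apply/seteqP; split. Qed.

Definition one_vertex_graph : lfgraph :=
  @LFGraph [set 0%N] (fun _ _ => false) (fun _ _ => erefl) (fun _ => erefl)
    (@edgeless_lf _).

Definition one_vertex_rooted : rooted_graph :=
  @Rooted one_vertex_graph (exist _ 0%N (mem_set erefl)).

HB.instance Definition _ := gen_eqMixin rooted_graph.
HB.instance Definition _ := gen_choiceMixin rooted_graph.
HB.instance Definition _ := isPointed.Build rooted_graph one_vertex_rooted.

Definition rooted_space := g_sigma_algebraType local_events.
HB.instance Definition _ := Measurable.on rooted_space.

Section random_rooted_graph.
Context (R : realType) (d : measure_display) (T : measurableType d).
Context (P : probability T R) (G : T -> rooted_space).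

Definition random_rooted_graph : Prop :=
  measurable_fun [set: T] G /\ {ae P, forall w, connected_graph (G w)}.

(* The law of (G, X_n): P is averaged over after averaging over the walk. *)
Definition law_at (n : nat) (A : set rooted_space) : \bar R :=
  (\int[P]_w (srw_expect (root_of (G w)) n
                (fun y => \1_A (Rooted y : rooted_space)))%:E)%E.

Definition stationary : Prop :=
  forall A : set rooted_space, measurable A -> law_at 0 A = law_at 1 A.

Definition as_polynomial_growth : Prop :=
  exists c e : R, [/\ 0 < c, 0 < e &
    {ae P, forall w, forall (x : vertex (G w)) (r : R), 1 <= r ->
       (#|` fset_set (gball x r)|)%:R <= c * r `^ e}].

(* E[d_G(X_0, X_n)^2 | (G, rho)] at the outcome w. *)
Definition mean_sq_displacement (n : nat) (w : T) : R :=
  srw_expect (root_of (G w)) n (fun y => (gdist (root_of (G w)) y)%:R ^+ 2).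

End random_rooted_graph.

(* Main.v *)
From HB Require Import structures.
Require Import Defs.
From mathcomp Require Import all_boot all_order all_algebra.
From mathcomp Require Import finmap zify lra.
From mathcomp Require Import all_classical all_reals all_analysis.
From mathcomp Require Import measurable_realfun.
Set Implicit Arguments.
Unset Strict Implicit.
Unset Printing Implicit Defensive.
Import Order.TTheory GRing.Theory Num.Theory.
Import numFieldNormedType.Exports.
Local Open Scope classical_set_scope.
Local Open Scope ring_scope.

(** The graph is a lamplighter graph over the plane whose lamps are shared by
all the edges of a large square, with squares of all scales at once.

A step moves the walker in Z^2 by a vector with entries 1 or -1. At scale [n],
with k = n + 1, the plane is cut into squares of side [side n] = 2^(4^k), and
the squares carry 4^k labels, arranged periodically with 2^k labels in each
direction. Each label of each scale is a lamp. Together with the move, the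
walker decides whether or not to toggle the lamps that label the edge it
crosses, at all scales simultaneously. The degree is therefore 8, and a uniform
step re-randomizes the lamps of the edge.

Superdiffusivity. Since a path of length [side n] meets at most nine labels of
scale [n], a state with D lit lamps of scale [n] is at distance at least [side
n] * (D / 9 - 1) from the dark one ([lit_gdist]). Let T be the squared period
([side n] * 2^k)^2. A planar walk of length T visits on average at least a
proportion of order 1 / k of the 4^k labels: this follows from a second moment
bound, because the expected number of visits to one label from any starting
point is at most of order k * [side n]^2 ([wexp_visits_le]). A lamp that has
been visited is lit with probability 1/2 ([wexp_toggled]). Hence the mean
squared displacement at time T is at least of order ([side n] * 4^k / k)^2 = T
* 4^k / k^2, while log T is of order 4^k ([mean_sq_displacement_ge]). This
holds in every environment, not only with high probability.

Growth. The squares are nested. In a ball of radius r, the labels of the scales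
coarser than the first scale N with [side N] >= 2 r are functions of the label of
scale N ([toggled_determined]), so that only the lamps of scales at most N
matter. There are O(4^N) of those, which is O(log r), whence polynomially many
configurations ([gball_lamp_growth]).

Stationarity. The position of the squares is given by two 2-adic integers, the
phases. Up to isomorphism the graph seen from a state depends only on the
phases shifted by the position of the walker, so it suffices that the phases
be Haar distributed. They are built from the digits of a uniform real number,
and the invariance is checked on the events which depend on finitely many
digits, where it is a matter of counting ([phase_event_law]); these events form
a pi-system and include the local ones ([local_events_phase]).
*)

(** * Averages over words *)

Section WordExpectation.
Context {R : realFieldType} {S : finType}.
Implicit Types f h : seq S -> R.

(** The law of the walk enters only through averages over uniform words, one
letter per step; the recursion peels off the first step, which is what the
first-step analysis below needs. *)
Fixpoint wexp n f : R :=
  if n is m.+1 then #|S|%:R^-1 * \sum_(g : S) wexp m (fun p => f (g :: p))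
  else f [::].

Lemma wexpS n f :
  wexp n.+1 f = #|S|%:R^-1 * \sum_(g : S) wexp n (fun p => f (g :: p)).
Proof. by []. Qed.

Lemma eq_wexp n f h :
  (forall p, size p = n -> f p = h p) -> wexp n f = wexp n h.
Proof.
elim: n f h => [|n IH] f h efh /=; first exact: efh.
by congr (_ * _); apply: eq_bigr => g _; apply: IH => p sp; apply: efh; rewrite /= sp.
Qed.

(** [srw_law] is defined by conditioning on the last step; this reconciles
the two recursions. *)
Lemma wexp_rcons n f :
  wexp n.+1 f = wexp n (fun p => #|S|%:R^-1 * \sum_(g : S) f (rcons p g)).
Proof.
elim: n f => [//|n IH] f.
rewrite [RHS]/= [LHS]wexpS; congr (_ * _).
by apply: eq_bigr => g _; rewrite IH.
Qed.

Lemma wexpD n f h : wexp n (fun p => f p + h p) = wexp n f + wexp n h.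
Proof.
elim: n f h => [//|n IH] f h /=.
by rewrite -mulrDr -big_split; congr (_ * _); apply: eq_bigr => g _; rewrite IH.
Qed.

Lemma wexpZ n (a : R) f : wexp n (fun p => a * f p) = a * wexp n f.
Proof.
elim: n f => [//|n IH] f /=.
rewrite mulrCA; congr (_ * _); rewrite mulr_sumr.
by apply: eq_bigr => g _; rewrite IH.
Qed.

Lemma wexp_sum n (I : Type) (r : seq I) (F : I -> seq S -> R) :
  wexp n (fun p => \sum_(i <- r) F i p) = \sum_(i <- r) wexp n (F i).
Proof.
elim: r => [|i r IH].
  rewrite big_nil -[RHS](mul0r (wexp n (fun=> 0))) -wexpZ.
  by apply: eq_wexp => p _; rewrite big_nil mul0r.
by rewrite big_cons -IH -wexpD; apply: eq_wexp => p _; rewrite big_cons.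
Qed.

Lemma le_wexp n f h :
  (forall p, size p = n -> f p <= h p) -> wexp n f <= wexp n h.
Proof.
elim: n f h => [|n IH] f h lefh /=; first exact: lefh.
rewrite ler_wpM2l ?invr_ge0 ?ler0n//; apply: ler_sum => g _.
by apply: IH => p sp; apply: lefh; rewrite /= sp.
Qed.

Hypothesis S_gt0 : (0 < #|S|)%N.

Lemma wexp_cst n (a : R) : wexp n (fun=> a) = a.
Proof.
elim: n => [//|n IH] /=.
by rewrite IH sumr_const -[a *+ _]mulr_natl mulKf// pnatr_eq0 -lt0n.
Qed.

(** Nonnegativity of the variance. *)
Lemma sqr_wexp_le n f : wexp n f ^+ 2 <= wexp n (fun p => f p ^+ 2).
Proof.
set m := wexp n f.
have : 0 <= wexp n (fun p => (f p - m) ^+ 2).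
  by rewrite -[leLHS](wexp_cst n); apply: le_wexp => p _; exact: sqr_ge0.
rewrite (eq_wexp (h := fun p => f p ^+ 2 + ((- 2 * m) * f p + m ^+ 2))); last first.
  by move=> p _; lra.
by rewrite !wexpD wexpZ wexp_cst -/m; nra.
Qed.

End WordExpectation.

Lemma gdistP (G : lfgraph) (x y : vertex G) : reachable x y ->
  walk_of_length (gdist x y) x y /\
  forall m, walk_of_length m x y -> (gdist x y <= m)%N.
Proof.
move=> rxy; apply: (@xgetPex _ 0%N [set n | walk_of_length n x y /\
  forall m, walk_of_length m x y -> (n <= m)%N]).
have ex : exists n, `[< walk_of_length n x y >].
  by case: rxy => n w; exists n; apply/asboolP.
case: (ex_minnP ex) => n /asboolP wn nmin.
by exists n; split=> // m wm; apply: nmin; apply/asboolP.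
Qed.

Section OrbitGraph.
Context {V : Type} {S : finType} {act : V -> S -> V} {inv : S -> S}.
Hypothesis act_inv : forall v g, act (act v g) (inv g) = v.
Hypothesis act_neq : forall v g, act v g <> v.
Hypothesis act_inj : forall v, injective (act v).
Variable v0 : V.

Definition run v (p : seq S) : V := foldl act v p.

(** Vertices have to be natural numbers, so a state is coded by a word that
leads to it. [choose] depends only on the set of these words, hence words with
the same endpoint get the same code. *)
Definition canon (p : seq S) : seq S :=
  choose (fun q => `[< run v0 q = run v0 p >]) p.

Lemma run_canon p : run v0 (canon p) = run v0 p.
Proof. by apply/asboolP/(@chooseP _ (fun q => `[< run v0 q = run v0 p >])); apply/asboolP. Qed.

Lemma canon_eq p q : run v0 p = run v0 q -> canon p = canon q.
Proof.
move=> epq; rewrite /canon epq; apply: choose_id; first exact/asboolP.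
exact/asboolP.
Qed.

Definition orbit_code : set nat := [set m | exists p, m = choice.pickle (canon p)].

Definition code_word (x : orbit_code) : seq S := odflt [::] (choice.unpickle (\val x)).

Definition state (x : orbit_code) : V := run v0 (code_word x).

Definition vtx_of (p : seq S) : orbit_code :=
  exist _ (choice.pickle (canon p)) (mem_set (ex_intro _ p erefl)).

Lemma code_word_vtx p : code_word (vtx_of p) = canon p.
Proof. by rewrite /code_word [\val _]/(choice.pickle _) choice.pickleK. Qed.

Lemma state_vtx p : state (vtx_of p) = run v0 p.
Proof. by rewrite /state code_word_vtx run_canon. Qed.

Lemma vtx_surj (x : orbit_code) : exists p, x = vtx_of p.
Proof.
case: x => m xm; have [p ep] := set_mem xm; exists p.
by apply: val_inj; rewrite /= ep.
Qed.

Lemma eq_vtx p q : (vtx_of p = vtx_of q) <-> (run v0 p = run v0 q).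
Proof.
split=> [e|e]; first by rewrite -!state_vtx e.
by apply: val_inj; rewrite /= (canon_eq e).
Qed.

Lemma state_inj : injective state.
Proof.
move=> x y; have [p ->] := vtx_surj x; have [q ->] := vtx_surj y.
by rewrite !state_vtx => e; apply/eq_vtx.
Qed.

Definition orbit_adj : rel orbit_code :=
  fun x y => `[< exists g, act (state x) g = state y >].

Lemma orbit_adj_sym : symmetric orbit_adj.
Proof.
by move=> x y; apply/asboolP/asboolP=> -[g <-]; exists (inv g); rewrite act_inv.
Qed.

Lemma orbit_adj_irr : irreflexive orbit_adj.
Proof. by move=> x; apply/asboolP => -[g /act_neq]. Qed.

Lemma run_rcons v p g : run v (rcons p g) = act (run v p) g.
Proof. by rewrite /run foldl_rcons. Qed.

Lemma run_cat v p q : run v (p ++ q) = run (run v p) q.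
Proof. by rewrite /run foldl_cat. Qed.

Definition nb (x : orbit_code) (g : S) : orbit_code := vtx_of (rcons (code_word x) g).

Lemma state_nb x g : state (nb x g) = act (state x) g.
Proof. by rewrite state_vtx run_rcons. Qed.

Lemma nbrs_nb x : [set y | orbit_adj x y] = range (nb x).
Proof.
apply/seteqP; split=> y /=.
  by move=> /asboolP[g e]; exists g => //; apply: state_inj; rewrite state_nb.
by move=> [g _ <-]; apply/asboolP; exists g; rewrite state_nb.
Qed.

Lemma orbit_adj_lf x : finite_set [set y | orbit_adj x y].
Proof. by rewrite nbrs_nb; apply: finite_image; exact: finite_finset. Qed.

Definition orbit_graph : lfgraph :=
  LFGraph orbit_adj_sym orbit_adj_irr orbit_adj_lf.

Definition vtx (p : seq S) : vertex orbit_graph := vtx_of p.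

Lemma vtx_nb p g : nb (vtx p) g = vtx (rcons p g).
Proof. by apply/eq_vtx; rewrite !run_rcons code_word_vtx run_canon. Qed.

Lemma adj_vtx p q : @adj orbit_graph (vtx p) (vtx q) <-> exists g, run v0 (rcons p g) = run v0 q.
Proof.
split=> [/asboolP[g]|[g e]]; first by rewrite !state_vtx -run_rcons; exists g.
by apply/asboolP; exists g; rewrite !state_vtx -run_rcons.
Qed.

(** Letters and edges correspond to each other, hence words and walks. *)
Lemma walk_vtx n p (y : vertex orbit_graph) :
  walk_of_length n (vtx p) y <-> exists2 q, size q = n & y = vtx (p ++ q).
Proof.
elim: n p y => [|n IH] p y /=.
  split=> [<-|[q /size0nil-> ->]]; last by rewrite cats0.
  by exists [::]; rewrite ?cats0.
split.
  move=> [z]; have [z' ->] := vtx_surj z; rewrite -/(vtx z').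
  move=> /adj_vtx[g /eq_vtx]; rewrite -!/(vtx _) => <- /IH[q sq ->].
  by exists (g :: q); rewrite /= ?sq// -cats1 -catA.
move=> [[|g q]//= [sq] ->]; exists (vtx (rcons p g)).
  by apply/adj_vtx; exists g.
by apply/IH; exists q => //; rewrite -cats1 -catA.
Qed.

Lemma orbit_graph_connected : connected_graph orbit_graph.
Proof.
move=> x y; have [p ->] := vtx_surj x; have [q ->] := vtx_surj y.
exists (size (rev (map inv p)) + size q)%N; apply/walk_vtx.
exists (rev (map inv p) ++ q); first by rewrite size_cat.
apply/eq_vtx; rewrite catA run_cat; congr run.
elim/last_ind: p => [//|p g IH].
rewrite map_rcons rev_rcons run_cat run_rcons /run [foldl _ _ (_ :: _)]/= act_inv.
by move: IH; rewrite run_cat.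
Qed.

Lemma gball_vtx (R : numDomainType) q (r : R) y :
  gball (vtx q) r y <-> exists p, (size p)%:R <= r /\ y = vtx (q ++ p).
Proof.
split=> [[rxy]|[p [pr ->]]].
  have [/walk_vtx[p <- ->] _] := gdistP rxy; by exists p.
have w : walk_of_length (size p) (vtx q) (vtx (q ++ p)) by apply/walk_vtx; exists p.
have rxy : reachable (vtx q) (vtx (q ++ p)) by exists (size p).
split=> //; have [_ /(_ _ w) le] := gdistP rxy.
by apply: le_trans pr; rewrite ler_nat.
Qed.

Lemma gdist_word q y : exists p, size p = gdist (vtx q) y /\ y = vtx (q ++ p).
Proof.
have [/walk_vtx[p sp ey] _] := gdistP (orbit_graph_connected (vtx q) y).
by exists p; split.
Qed.

Section Walk.
Context {R : realType}.
Hypothesis S_gt0 : (0 < #|S|)%N.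

Lemma nb_inj x : injective (nb x).
Proof. by move=> g h /(congr1 state); rewrite !state_nb => /act_inj. Qed.

Lemma degree_orbit_graph (x : vertex orbit_graph) : degree x = #|S|.
Proof.
rewrite /degree /nbrs /= nbrs_nb.
have -> : range (nb x) = [set` [fset nb x g | g : S]%fset].
  apply/seteqP; split=> y /=; first by move=> [g _ <-]; rewrite in_imfset.
  by move=> /imfsetP[g _ ->]; exists g.
by rewrite set_fsetK card_imfset//=; [rewrite cardE|exact: nb_inj].
Qed.

Lemma srw_step_nb (x y : vertex orbit_graph) :
  srw_step R x y = #|S|%:R^-1 * \sum_(g : S) (nb x g == y)%:R.
Proof.
rewrite /srw_step degree_orbit_graph gtn_eqF//.
case: ifPn => [|nadj].
  have : (@adj orbit_graph x y) = true -> range (nb x) y.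
    by move=> ?; rewrite -nbrs_nb.
  move=> /[apply] -[g _ <-]; rewrite (bigD1 g)//= eqxx big1 ?addr0 ?mulr1//.
  by move=> h hg; rewrite (inj_eq (@nb_inj x)) (negbTE hg).
rewrite big1 ?mulr0// => g _; case: eqP => // e; case/negP: nadj.
have : range (nb x) y by exists g.
by rewrite -nbrs_nb.
Qed.

(** The words of length [n] reach finitely many points, which makes the sum
over all vertices finite. *)
Lemma fsum_wexp (T : choiceType) n (F : seq S -> T) (h : T -> R) :
  \sum_(z \in [set: T]) wexp n (fun p => (F p == z)%:R) * h z =
  wexp n (fun p => h (F p)).
Proof.
pose A := [fset F (\val t) | t : n.-tuple S]%fset.
have FA p : size p = n -> F p \in A.
  by move=> /eqP sp; apply/imfsetP; exists (Tuple sp).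
rewrite (@fsbigTE _ _ _ _ A); last first.
  move=> z zA; rewrite (eq_wexp (h := fun=> 0)) ?wexp_cst ?mul0r// => p sp.
  by case: eqP => // e; move: zA; rewrite -e FA.
rewrite (eq_bigr (fun z => wexp n (fun p => (F p == z)%:R * h z))); last first.
  move=> z _; rewrite mulrC -wexpZ; apply: eq_wexp => p _; exact: mulrC.
rewrite -wexp_sum; apply: eq_wexp => p sp.
rewrite (bigD1_seq (F p)) ?FA//= eqxx mul1r big1 ?addr0// => z.
by rewrite eq_sym => /negbTE ->; rewrite mul0r.
Qed.

Lemma srw_law_vtx q n y :
  srw_law R (vtx q) n y = wexp n (fun p => (vtx (q ++ p) == y)%:R).
Proof.
elim: n y => [|n IH] y; first by rewrite /= cats0.
rewrite wexp_rcons [LHS]/=.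
under eq_fsbigr do rewrite IH.
rewrite (fsum_wexp n (fun p => vtx (q ++ p))).
apply: eq_wexp => p _; rewrite srw_step_nb; congr (_ * _).
by apply: eq_bigr => g _; rewrite vtx_nb rcons_cat.
Qed.

(** Distinct letters lead to distinct neighbours, so a uniform letter is a
step of the simple random walk. *)
Lemma srw_expect_vtx q n (f : vertex orbit_graph -> R) :
  srw_expect (vtx q) n f = wexp n (fun p => f (vtx (q ++ p))).
Proof.
rewrite /srw_expect -(fsum_wexp n (fun p => vtx (q ++ p))).
by apply: eq_fsbigr => y _; rewrite srw_law_vtx.
Qed.

End Walk.
End OrbitGraph.

Section OrbitIso.
Context {S : finType} {V1 V2 : Type}.
Context {act1 : V1 -> S -> V1} {inv1 : S -> S}.
Hypothesis act1_inv : forall v g, act1 (act1 v g) (inv1 g) = v.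
Hypothesis act1_neq : forall v g, act1 v g <> v.
Context {act2 : V2 -> S -> V2} {inv2 : S -> S}.
Hypothesis act2_inv : forall v g, act2 (act2 v g) (inv2 g) = v.
Hypothesis act2_neq : forall v g, act2 v g <> v.
Variables (v1 : V1) (v2 : V2) (q1 q2 : seq S) (r : nat).
Hypothesis same : forall p p', (size p <= r.+1)%N -> (size p' <= r.+1)%N ->
  run (act := act1) v1 (q1 ++ p) = run (act := act1) v1 (q1 ++ p') <->
  run (act := act2) v2 (q2 ++ p) = run (act := act2) v2 (q2 ++ p').

Let G1 := orbit_graph act1_inv act1_neq v1.
Let G2 := orbit_graph act2_inv act2_neq v2.
Let vtx1 := vtx act1_inv act1_neq v1.
Let vtx2 := vtx act2_inv act2_neq v2.

(** A rooted ball in an orbit graph is determined by which short words have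
the same endpoint. Words of length [r.+1] are needed for the edges between
vertices at distance [r] from the root. *)
Lemma ball_iso_orbit :
  ball_iso r (@Rooted G1 (vtx1 q1)) (@Rooted G2 (vtx2 q2)).
Proof.
pose word (y : vertex G1) : seq S :=
  xget [::] [set p | (size p <= r)%N /\ y = vtx1 (q1 ++ p)].
have same_vtx p p' : (size p <= r.+1)%N -> (size p' <= r.+1)%N ->
  vtx1 (q1 ++ p) = vtx1 (q1 ++ p') <-> vtx2 (q2 ++ p) = vtx2 (q2 ++ p').
  have e1 a b : vtx1 a = vtx1 b <-> run v1 a = run v1 b := eq_vtx v1 a b.
  have e2 a b : vtx2 a = vtx2 b <-> run v2 a = run v2 b := eq_vtx v2 a b.
  by move=> sp sp'; rewrite e1 e2; exact: same.
have wordP p : (size p <= r)%N ->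
    (size (word (vtx1 (q1 ++ p))) <= r)%N /\
    vtx1 (q1 ++ p) = vtx1 (q1 ++ word (vtx1 (q1 ++ p))).
  move=> sp; rewrite /word; set P := (X in xget _ X).
  have /(xgetPex [::]) : exists w, P w by exists p.
  by [].
pose f (y : vertex G1) := vtx2 (q2 ++ word y).
have fE p : (size p <= r)%N -> f (vtx1 (q1 ++ p)) = vtx2 (q2 ++ p).
  move=> sp; have [sw ew] := wordP _ sp.
  by rewrite /f; apply/same_vtx; rewrite -?ew//; exact: leqW.
exists f; split => /=.
- split.
  + move=> y /gball_vtx[p [+ ->]]; rewrite natz lez_nat => sp; rewrite fE//.
    by apply/gball_vtx; exists p; rewrite natz lez_nat.
  + move=> x y /set_mem/gball_vtx[p [+ ->]] /set_mem/gball_vtx[p' [+ ->]].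
    rewrite !natz !lez_nat => sp sp'; rewrite !fE// => e.
    by apply/same_vtx => //; apply: leqW.
  + move=> y /gball_vtx[p [+ ->]]; rewrite natz lez_nat => sp.
    exists (vtx1 (q1 ++ p)); last exact: fE.
    by apply/gball_vtx; exists p; rewrite natz lez_nat.
- by rewrite -[in LHS](cats0 q1) -[in RHS](cats0 q2) fE.
- move=> x y /gball_vtx[p [+ ->]] /gball_vtx[p' [+ ->]].
  rewrite !natz !lez_nat => sp sp'; rewrite !fE//.
  have a1 a b : adj (vtx1 a) (vtx1 b) <->
      exists g, run (act := act1) v1 (rcons a g) = run (act := act1) v1 b.
    exact: (adj_vtx act1_inv act1_neq v1 a b).
  have a2 a b : adj (vtx2 a) (vtx2 b) <->
      exists g, run (act := act2) v2 (rcons a g) = run (act := act2) v2 b.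
    exact: (adj_vtx act2_inv act2_neq v2 a b).
  apply/idP/idP => [/a2|/a1] [g e]; [apply/a1|apply/a2]; exists g; move: e;
    rewrite !rcons_cat => e; (apply/same => //; rewrite ?size_rcons//; exact: leqW).
Qed.

End OrbitIso.

(** * Binary scales on the line *)

(** The exponents balance two constraints. The number of lamps of scale [n],
[nlabels n ^ 2] = 4^(n+1), is the binary logarithm of [side n]: it is of the
order of the logarithm of the times at which scale [n] is used, and all the
lamps of scales at most [n] together are still logarithmic in [side n.-1]. *)
Definition label_exp (n : nat) : nat := n.+1.
Definition side_exp (n : nat) : nat := (4 ^ n.+1)%N.
Definition nlabels (n : nat) : nat := (2 ^ label_exp n)%N.
Definition side (n : nat) : nat := (2 ^ side_exp n)%N.
Definition level (n : nat) : nat := (side_exp n + label_exp n)%N.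

Lemma side_gt0 n : (0 < side n)%N. Proof. by rewrite expn_gt0. Qed.
Lemma nlabels_gt1 n : (1 < nlabels n)%N.
Proof. by rewrite -[1%N](expn0 2) ltn_exp2l. Qed.
Lemma nlabels_gt0 n : (0 < nlabels n)%N. Proof. by rewrite expn_gt0. Qed.
Lemma period_level n : (side n * nlabels n)%N = (2 ^ level n)%N.
Proof. by rewrite expnD. Qed.

Lemma side_unbounded k : exists N, (k <= side N)%N.
Proof.
exists k; apply: ltnW; apply: leq_trans (ltn_expl k (isT : 1 < 2)%N) _.
rewrite leq_exp2l//; apply: leq_trans (leqnSn k) (ltnW (ltn_expl _ _)).
by [].
Qed.

Lemma side_exp_le m n : (m <= n)%N -> (side_exp m <= side_exp n)%N.
Proof. by move=> mn; rewrite leq_exp2l. Qed.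

Lemma level_le m n : (m <= n)%N -> (level m <= level n)%N.
Proof. by move=> mn; rewrite leq_add// side_exp_le. Qed.

(** A 2-adic integer, given by representatives of its residues modulo 2^m. *)
Definition coherent (ph : nat -> int) : Prop :=
  forall m n, (m <= n)%N -> exists t : int, ph n = ph m + t * (2 ^ m)%N.

Lemma divz_bounds (u : int) (d : nat) : (0 < d)%N ->
  0 <= u - (u %/ d)%Z * d < d.
Proof.
move=> d0; rewrite {1 3}(divz_eq u d) addrAC subrr add0r.
by rewrite modz_ge0 ?ltz_pmod//; lia.
Qed.

Lemma quotient_gap (x x' u u' d : int) : 0 <= x - u * d < d ->
  0 <= x' - u' * d < d -> x - x' <= d -> u - u' <= 1.
Proof.
move=> b b' xx'; rewrite -ltzD1 -(@ltr_pM2r _ d); last by lia.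
by rewrite mulrBl mulrDl mul1r; lia.
Qed.

Definition lab1 (ph : nat -> int) n (a : int) : nat :=
  `|(((ph (level n) + a)%R %/ side n)%Z %% nlabels n)%Z|%N.

Lemma lab1E ph n a : lab1 ph n a = (((ph (level n) + a)%R %/ side n)%Z %% nlabels n)%Z :> int.
Proof. by rewrite /lab1 gez0_abs// modz_ge0//; have := nlabels_gt0 n; lia. Qed.

Lemma lab1_lt ph n a : (lab1 ph n a < nlabels n)%N.
Proof. by rewrite -ltz_nat lab1E ltz_pmod// ltz_nat nlabels_gt0. Qed.

Lemma lab1_congr ph ph' n a a' (t : int) :
  ph (level n) + a = ph' (level n) + a' + t * (2 ^ level n)%N ->
  lab1 ph n a = lab1 ph' n a'.
Proof.
move=> e; have L0 := side_gt0 n; apply: (can_inj absz_nat).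
rewrite /= !lab1E e -period_level PoszM addrC mulrCA.
by rewrite [_ * (t * _)]mulrC divzMDl ?modzMDl//; lia.
Qed.

(** Every boundary of a coarser scale is a boundary of scale [N]. A stretch
shorter than [side N] meets at most two consecutive intervals of scale [N],
which have different labels as there are at least two labels; so points of the
stretch with the same label lie in the same interval of scale [N], hence of
scale [n]. *)
Lemma lab1_window ph N n a a' : coherent ph -> (N <= n)%N ->
  `|a - a'| < (side N)%:Z -> lab1 ph N a = lab1 ph N a' ->
  lab1 ph n a = lab1 ph n a'.
Proof.
move=> coh Nn aa' elab; have L0 := side_gt0 N; have K1 := nlabels_gt1 N.
have [t et] := coh _ _ (level_le Nn).
have q_eq : ((ph (level N) + a) %/ side N)%Z = ((ph (level N) + a') %/ side N)%Z.
  move/(congr1 Posz): elab; rewrite !lab1E => elab.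
  have := divz_bounds (ph (level N) + a) L0.
  have := divz_bounds (ph (level N) + a') L0.
  move: elab; set u := (_ %/ _)%Z; set u' := ((ph _ + a') %/ _)%Z => elab b2 b1.
  have d1 : u - u' <= 1 by apply: (quotient_gap b1 b2); lia.
  have d2 : u' - u <= 1 by apply: (quotient_gap b2 b1); lia.
  have /eqP := elab; rewrite eqz_mod_dvd => /dvdzP[w ew].
  have K2 : 2 <= (nlabels N)%:Z by rewrite lez_nat.
  case: (ltrgtP w 0) => w0; last by move: ew; rewrite w0 mul0r; lia.
    have : (nlabels N)%:Z <= (- w) * nlabels N by rewrite ler_peMl//; lia.
    by rewrite mulNr -ew; lia.
  have : (nlabels N)%:Z <= w * nlabels N by rewrite ler_peMl//; lia.
  by rewrite -ew; lia.
have side_div : exists s : nat, side n = (side N * 2 ^ s)%N.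
  by exists (side_exp n - side_exp N)%N; rewrite /side -expnD subnKC// side_exp_le.
have [s es] := side_div.
have lev : (2 ^ level N)%N = (nlabels N * side N)%N by rewrite mulnC period_level.
apply: (can_inj absz_nat); rewrite /= !lab1E et es PoszM.
rewrite !divzMA_ge0// ![_ + t * _]addrC -!addrA lev PoszM mulrA.
by rewrite !divzMDl ?q_eq//; lia.
Qed.

(** A stretch of length twice the side meets at most three intervals. *)
Lemma lab1_three ph n (a0 a : int) : a0 - (side n)%:Z <= a -> a < a0 + (side n)%:Z ->
  lab1 ph n a \in [:: lab1 ph n (a0 - (side n)%:Z); lab1 ph n a0; lab1 ph n (a0 + (side n)%:Z)].
Proof.
move=> ge lt; have L0 := side_gt0 n.
have lab_of x y : ((ph (level n) + x) %/ side n)%Z = ((ph (level n) + y) %/ side n)%Z ->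
    lab1 ph n x = lab1 ph n y by rewrite /lab1 => ->.
have shiftE (x e : int) : ((ph (level n) + (x + e * side n)) %/ side n)%Z =
    e + ((ph (level n) + x) %/ side n)%Z.
  by rewrite addrA addrC divzMDl//; lia.
have shift1 := shiftE a0 1; have shiftN := shiftE a0 (-1).
rewrite mul1r in shift1; rewrite mulN1r in shiftN.
rewrite !inE; apply/orP.
have := divz_bounds (ph (level n) + a) L0.
have := divz_bounds (ph (level n) + a0) L0.
move: (lab_of a) shift1 shiftN.
set u := ((ph (level n) + a) %/ _)%Z; set u' := ((ph (level n) + a0) %/ _)%Z.
move=> lab_a s1 sN b1 b2.
have d1 : u - u' <= 1 by apply: (quotient_gap b2 b1); lia.
have d2 : u' - u <= 1 by apply: (quotient_gap b1 b2); lia.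
have : u - u' = -1 \/ u - u' = 0 \/ u - u' = 1 by lia.
move=> [d|[d|d]].
- by left; apply/eqP; apply: lab_a; rewrite sN; lia.
- by right; apply/orP; left; apply/eqP; apply: lab_a; rewrite -/u'; lia.
- by right; apply/orP; right; apply/eqP; apply: lab_a; rewrite s1; lia.
Qed.

(** Labels recur with period [side n * nlabels n = 2 ^ level n], so a label
is a window of residues. *)
Lemma lab1_residue ph n c : exists s : int, forall a,
  lab1 ph n a = c -> ((a + s) %% (2 ^ level n)%N)%Z < side n.
Proof.
exists (ph (level n) - c%:Z * side n) => a.
move/(congr1 Posz); rewrite lab1E => elab; have L0 := side_gt0 n.
have P0 : (0 < (2 ^ level n)%N)%N by rewrite expn_gt0.
have eK := divz_eq ((ph (level n) + a) %/ side n)%Z (nlabels n).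
have := divz_bounds (ph (level n) + a) L0.
set r := (X in 0 <= X < _) => /andP[r_ge r_lt].
have -> : a + (ph (level n) - c%:Z * side n) =
    (((ph (level n) + a) %/ side n)%Z %/ nlabels n)%Z * (2 ^ level n)%N + r.
  rewrite /r -period_level PoszM [(side n)%:Z * _]mulrC mulrA.
  by rewrite [X in X * _ + _](_ : _ = ((ph (level n) + a) %/ side n)%Z - c%:Z); lia.
rewrite modzMDl modz_small ?r_lt// r_ge; apply: lt_le_trans r_lt _.
by rewrite -period_level lez_nat leq_pmulr// nlabels_gt0.
Qed.

(** * The lamp graph *)

Definition dir : finType := (bool * bool * bool)%type.
Definition phases := ((nat -> int) * (nat -> int))%type.
Definition lamps := (nat -> nat * nat -> bool)%type.

Definition move1 (s : bool) (a : int) : int := if s then a + 1 else a - 1.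
Definition low1 (s : bool) (a : int) : int := if s then a else a - 1.
Definition move (z : int * int) (g : dir) : int * int :=
  (move1 g.1.1 z.1, move1 g.1.2 z.2).
(** An edge is named by the lower left corner of the unit square in which it
is a diagonal; this does not depend on its orientation. *)
Definition corner (z : int * int) (g : dir) : int * int :=
  (low1 g.1.1 z.1, low1 g.1.2 z.2).
Definition lab2 (ph : phases) n (e : int * int) : nat * nat :=
  (lab1 ph.1 n e.1, lab1 ph.2 n e.2).

(** The letter toggles lamps of all scales at once: the degree stays bounded
although every scale has its own lamps. *)
Definition step (ph : phases) (v : (int * int) * lamps) (g : dir) :
    (int * int) * lamps :=
  (move v.1 g, fun n c => v.2 n c (+) (g.2 && (lab2 ph n (corner v.1 g) == c))).
Definition back (g : dir) : dir := (~~ g.1.1, ~~ g.1.2, g.2).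

Lemma card_dir : #|dir| = 8. Proof. by rewrite !card_prod card_bool. Qed.

Lemma move_back z g : move (move z g) (back g) = z.
Proof. by case: z g => a b [[[] []] d]; rewrite /move /move1 /=; congr pair; lia. Qed.

Lemma corner_back z g : corner (move z g) (back g) = corner z g.
Proof. by case: z g => a b [[[] []] d]; rewrite /corner /low1 /=; congr pair; lia. Qed.

Lemma step_back ph v g : step ph (step ph v g) (back g) = v.
Proof.
case: v => z w; rewrite /step /= move_back corner_back; congr pair.
by apply/funext => n; apply/funext => c; rewrite addbK.
Qed.

Lemma move_inj z g h : move z g = move z h -> g.1 = h.1.
Proof.
by case: g h => [[[] []] d] [[[] []] d'] // []; rewrite /move1 /=; lia.
Qed.

Lemma step_neq ph v g : step ph v g <> v.
Proof.
case: v g => -[a b] w [[s t] d] /(congr1 (fun v => v.1.1)) /=.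
by rewrite /move1; case: s; lia.
Qed.

(** Letters with the same move differ in the toggling, which any single
scale makes visible. *)
Lemma step_inj ph v : injective (step ph v).
Proof.
move=> g h e; have eg : g.1 = h.1 by exact: (move_inj (congr1 fst e)).
have ec : corner v.1 g = corner v.1 h by rewrite /corner eg.
have := congr1 (fun x => x.2 0%N (lab2 ph 0 (corner v.1 g))) e.
rewrite /= ec !eqxx !andbT => /addbI; case: g h eg {e ec} => [x d] [y d'] /= -> ->.
by [].
Qed.

Fixpoint endpt z (p : seq dir) : int * int :=
  if p is g :: p' then endpt (move z g) p' else z.

Fixpoint toggled ph z (p : seq dir) : lamps := fun n c =>
  if p is g :: p' then (g.2 && (lab2 ph n (corner z g) == c)) (+)
                       toggled ph (move z g) p' n c
  else false.

Fixpoint corners z (p : seq dir) : seq (int * int) :=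
  if p is g :: p' then corner z g :: corners (move z g) p' else [::].

Definition dark : lamps := fun _ _ => false.

Lemma run_step ph z w p : run (act := step ph) (z, w) p =
  (endpt z p, fun n c => w n c (+) toggled ph z p n c).
Proof.
elim: p z w => [|g p IH] z w.
  by congr pair; apply/funext => n; apply/funext => c; rewrite addbF.
rewrite [LHS](IH (move z g)) /=; congr pair.
by apply/funext => n; apply/funext => c; rewrite addbA.
Qed.

(** The configuration is compared lamp by lamp, although it has infinite
support. *)
Lemma run_dark_eq ph z p q :
  run (act := step ph) (z, dark) p = run (act := step ph) (z, dark) q <->
  endpt z p = endpt z q /\
  (forall n c, toggled ph z p n c = toggled ph z q n c).
Proof.
rewrite !run_step; split=> [[-> e]|[-> e]].
  split=> // n c; have := congr1 (fun f => f n c) e; by [].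
congr pair; apply/funext => n; apply/funext => c; by rewrite e.
Qed.

Lemma endpt_cat z p q : endpt z (p ++ q) = endpt (endpt z p) q.
Proof. by elim: p z => //= g p IH z. Qed.

Lemma toggled_cat ph z p q n c : toggled ph z (p ++ q) n c =
  toggled ph z p n c (+) toggled ph (endpt z p) q n c.
Proof. by elim: p z => //= g p IH z; rewrite IH addbA. Qed.

Lemma corners_near z p (e : int * int) : e \in corners z p ->
  (z.1 - (size p)%:Z <= e.1 < z.1 + (size p)%:Z) /\
  (z.2 - (size p)%:Z <= e.2 < z.2 + (size p)%:Z).
Proof.
elim: p z => [//|g p IH] z; rewrite [corners _ _]/= inE => /orP[/eqP ->|/IH].
  case: g => [[s t] d]; rewrite /corner /low1 /=.
  by case: s; case: t => /=; split; lia.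
case: g => [[s t] d]; rewrite /move /move1 /=.
by case: s; case: t => -[]; split; lia.
Qed.

Definition labels n : seq (nat * nat) :=
  [seq (i, j) | i <- iota 0 (nlabels n), j <- iota 0 (nlabels n)].

Lemma labels_uniq n : uniq (labels n).
Proof. by apply: allpairs_uniq; rewrite ?iota_uniq// => -[? ?] [? ?] _ _ [-> ->]. Qed.

Lemma lab2_labels ph n (e : int * int) : lab2 ph n e \in labels n.
Proof.
by apply/allpairsP; exists (lab2 ph n e); rewrite !mem_iota/= !add0n !lab1_lt; split.
Qed.

(** When the labels of one scale are functions of those of another, the
lamps of the former count, modulo 2, the lamps of the latter above them. *)
Lemma toggled_pushforward ph z p N n (f : nat * nat -> nat * nat) c :
  {in corners z p, forall e, lab2 ph n e = f (lab2 ph N e)} ->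
  toggled ph z p n c =
  \big[addb/false]_(c' <- labels N) ((f c' == c) && toggled ph z p N c').
Proof.
elim: p z => [|g p IH] z fE /=.
  by rewrite big1// => c' _; rewrite andbF.
rewrite IH; last by move=> e pe; apply: fE; rewrite inE pe orbT.
under [in RHS]eq_bigr do rewrite andb_addr.
rewrite big_split /=; congr (_ (+) _).
rewrite fE ?mem_head//.
rewrite (bigD1_seq (lab2 ph N (corner z g))) ?lab2_labels ?labels_uniq//=.
rewrite eqxx big1 ?addbF ?andbT 1?andbC// => c'.
by rewrite eq_sym => /negbTE ->; rewrite !andbF.
Qed.

(** By [lab1_window] the coarse labels met by words of length at most [k] are
functions of the labels of scale [N]: the infinitely many coarse lamps carry no
more information than those of scale [N]. *)
Lemma toggled_determined ph z p q k N n :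
  coherent ph.1 -> coherent ph.2 -> (N <= n)%N -> (2 * k <= side N)%N ->
  (size p <= k)%N -> (size q <= k)%N ->
  (forall c, toggled ph z p N c = toggled ph z q N c) ->
  forall c, toggled ph z p n c = toggled ph z q n c.
Proof.
move=> coh1 coh2 Nn kN pk qk e c.
pose win (x : int * int) : Prop := (z.1 - k%:Z <= x.1 < z.1 + k%:Z) /\
  (z.2 - k%:Z <= x.2 < z.2 + k%:Z).
have winP r : (size r <= k)%N -> forall x : int * int, x \in corners z r -> win x.
  move=> rk x /corners_near[h1 h2]; rewrite /win; split; lia.
pose f c' := xget (0%N, 0%N)
  [set c | exists2 x, win x & lab2 ph N x = c' /\ lab2 ph n x = c].
have fE x : win x -> lab2 ph n x = f (lab2 ph N x).
  move=> wx; have /(xgetPex (0%N, 0%N)) : exists c, exists2 y, win y &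
      lab2 ph N y = lab2 ph N x /\ lab2 ph n y = c by exists (lab2 ph n x), x.
  rewrite -/(f _) => -[y wy [[e1 e2] <-]]; move: wx wy; rewrite /win => wx wy.
  by congr pair; apply: lab1_window; eauto; lia.
rewrite !(@toggled_pushforward _ _ _ N n f) => [|x /winP-/(_ qk)|x /winP-/(_ pk)].
- by apply: eq_bigr => c' _; rewrite e.
- exact: fE.
- exact: fE.
Qed.

Definition lit ph n z p : nat := count (toggled ph z p n) (labels n).

Lemma lit_cat ph n z p q :
  (lit ph n z (p ++ q) <= lit ph n z p + lit ph n (endpt z p) q)%N.
Proof.
rewrite /lit -count_predUI; apply: leq_trans (leq_addr _ _).
by apply: sub_count => c; rewrite /= toggled_cat; case: toggled => /= [_|->].
Qed.

Lemma toggled_corner ph z p n c : toggled ph z p n c ->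
  exists2 e, e \in corners z p & lab2 ph n e = c.
Proof.
elim: p z => [//|g p IH] z /=.
case: (boolP (g.2 && _)) => [/andP[_ /eqP <-] _|_ /IH[e ep ec]].
  by exists (corner z g); rewrite ?mem_head.
by exists e; rewrite // inE ep orbT.
Qed.

(** In each coordinate, at most three intervals are within reach of the word. *)
Lemma lit_short ph n z p : (size p <= side n)%N -> (lit ph n z p <= 9)%N.
Proof.
move=> sp; rewrite /lit -size_filter.
pose three ph' a := [:: lab1 ph' n (a - (side n)%:Z); lab1 ph' n a; lab1 ph' n (a + (side n)%:Z)].
pose near := [seq (i, j) | i <- three ph.1 z.1, j <- three ph.2 z.2].
have -> : 9%N = size near by rewrite size_allpairs.
apply: uniq_leq_size; first by rewrite filter_uniq ?labels_uniq.
move=> c; rewrite mem_filter => /andP[/toggled_corner[e /corners_near[h1 h2] <-] _].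
by apply/allpairsP; exists (lab2 ph n e); split => //; apply: lab1_three; lia.
Qed.

(** The word is cut into stretches of length [side n]. *)
Lemma lit_le ph n z p : (lit ph n z p <= 9 * (size p %/ side n).+1)%N.
Proof.
have [m] := ubnP (size p); elim: m z p => // m IH z p.
case: (leqP (size p) (side n)) => [sp _|sp lep].
  by apply: leq_trans (lit_short _ _ sp) _; rewrite leq_pmulr.
rewrite -{1}(cat_take_drop (side n) p).
apply: leq_trans (lit_cat _ _ _ _ _) _.
have s1 : (lit ph n z (take (side n) p) <= 9)%N.
  by apply: lit_short; rewrite size_take sp.
have s2 : (lit ph n (endpt z (take (side n) p)) (drop (side n) p) <=
    9 * ((size p - side n) %/ side n).+1)%N.
  rewrite -size_drop; apply: IH; rewrite size_drop; have := side_gt0 n; lia.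
have -> : (size p %/ side n)%N = ((size p - side n) %/ side n).+1.
  by rewrite -{1}(subnK (ltnW sp)) addnC divnDl ?dvdnn// divnn side_gt0.
by rewrite mulnS leq_add.
Qed.

Definition lamp_graph (ph : phases) (z : int * int) : lfgraph :=
  orbit_graph (@step_back ph) (@step_neq ph) (z, dark).

Definition lamp_vtx ph z p : vertex (lamp_graph ph z) :=
  vtx (@step_back ph) (@step_neq ph) (z, dark) p.

(** The lit lamps depend only on the endpoint, so they can be counted along a
geodesic instead of [p]. *)
Lemma lit_gdist ph n z p :
  (lit ph n z p <= 9 * (gdist (lamp_vtx ph z [::]) (lamp_vtx ph z p) %/ side n).+1)%N.
Proof.
have [q [<- epq]] := @gdist_word _ _ _ _ (@step_back ph) (@step_neq ph) (z, dark) [::]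
  (lamp_vtx ph z p).
have /run_dark_eq[_ e] : run (act := step ph) (z, dark) p = run (act := step ph) (z, dark) q.
  exact/eq_vtx.
apply: leq_trans (lit_le ph n z q); rewrite /lit.
by apply: eq_leq; apply: eq_count => c; rewrite e.
Qed.

(** * Binomial coefficients along residue classes *)

Section Unimodal.
Variables (f : nat -> nat) (h : nat).
Hypothesis f_incr : forall i j, (i <= j <= h)%N -> (f i <= f j)%N.
Hypothesis f_decr : forall i j, (h <= i <= j)%N -> (f j <= f i)%N.

Lemma unimodal_max i : (f i <= f h)%N.
Proof.
by case: (leqP i h) => ih; [apply: f_incr; rewrite ih/=|apply: f_decr; rewrite leqnn ltnW].
Qed.

Lemma block_le a m v : (forall i, (a <= i < a + m)%N -> (v <= f i)%N) ->
  (\sum_(0 <= i < a) f i + m * v <= \sum_(0 <= i < a + m) f i)%N.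
Proof.
move=> vf; rewrite (@big_cat_nat _ _ _ a 0 (a + m)) ?leq_addr//= leq_add2l.
rewrite -{1}(addKn a m) -sum_nat_const_nat [leqLHS]big_nat_cond [leqRHS]big_nat_cond.
by apply: leq_sum => i; rewrite andbT; exact: vf.
Qed.

Lemma sum_prefix_le a b : (a <= b)%N ->
  (\sum_(0 <= i < a) f i <= \sum_(0 <= i < b) f i)%N.
Proof. by move=> ab; rewrite (@big_cat_nat _ _ _ a 0 b)//= leq_addr. Qed.

(** A term of the progression that is not next to the peak is at most the
average of [f] over the block of [m] integers that separates it from its
neighbour on the side of the peak. These blocks are disjoint, and at most two
terms are left, each bounded by the maximum. *)
Lemma unimodal_progression c m n :
  (m * \sum_(0 <= k < n) f (c + k * m) <=
   2 * m * f h + \sum_(0 <= i < c + n * m) f i)%N.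
Proof.
(* Invariant of the induction: the next term is not past the peak; or it is,
   and one term at most has been bounded by the maximum; or two have been. *)
have [[e S]|[[e S]|[[n0 e] S]]] :
    (c + n * m <= h.+1 /\
       m * \sum_(0 <= k < n) f (c + k * m) <= \sum_(0 <= i < c + n * m) f i)%N \/
    ((h.+1 < c + n * m /\ m * \sum_(0 <= k < n) f (c + k * m) <=
       m * f h + \sum_(0 <= i < c + n.-1 * m) f i)%N \/
    ((0 < n /\ h.+1 < c + n.-1 * m) /\ m * \sum_(0 <= k < n) f (c + k * m) <=
       2 * m * f h + \sum_(0 <= i < c + n.-1 * m) f i)%N); last first.
- apply: leq_trans S _; rewrite leq_add2l; apply: sum_prefix_le.
  by rewrite leq_add2l leq_mul2r leq_pred orbT.
- apply: leq_trans S _; apply: leq_add; first by rewrite leq_mul2r leq_pmull ?orbT.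
  by apply: sum_prefix_le; rewrite leq_add2l leq_mul2r leq_pred orbT.
- exact: leq_trans S (leq_addl _ _).
elim: n => [|n [[e S]|[[e S]|[[n0 e] S]]]].
- rewrite big_nil muln0 addn0; case: (leqP c h.+1) => ch; first by left.
  by right; left.
- rewrite big_nat_recr//= mulnDr.
  case: (leqP (c + n.+1 * m) h.+1) => ch; [left|right; left]; split=> //.
    apply: leq_trans (leq_add S (leqnn _)) _.
    rewrite mulSn [(m + _)%N]addnC addnA; apply: block_le => i hi.
    by apply: f_incr; move: ch; rewrite mulSn; lia.
  by rewrite addnC leq_add// leq_mul2l unimodal_max orbT.
- right; right; split=> //; rewrite big_nat_recr//= mulnDr -mulnA mul2n -addnn.
  rewrite addnC -addnA; apply: leq_add; first by rewrite leq_mul2l unimodal_max orbT.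
  apply: leq_trans S _; rewrite leq_add2l; apply: sum_prefix_le.
  by rewrite leq_add2l leq_mul2r leq_pred orbT.
- right; right; split; first by rewrite (leq_trans e)// leq_add2l leq_mul2r leq_pred orbT.
  rewrite big_nat_recr//= mulnDr; apply: leq_trans (leq_add S (leqnn _)) _.
  have -> : (c + n * m = c + n.-1 * m + m)%N by rewrite -{1}(prednK n0) mulSn; lia.
  rewrite -addnA leq_add2l; apply: block_le => i hi.
  by apply: f_decr; lia.
Qed.

End Unimodal.

Lemma bin_step_up j i : (2 * i < j)%N -> ('C(j, i) <= 'C(j, i.+1))%N.
Proof.
move=> ij; rewrite -(leq_pmul2l (m := i.+1))// mul_bin_left leq_mul2r; lia.
Qed.

Lemma bin_step_down j i : (j <= (2 * i).+1)%N -> ('C(j, i.+1) <= 'C(j, i))%N.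
Proof.
move=> ij; rewrite -(leq_pmul2l (m := i.+1))// mul_bin_left leq_mul2r; lia.
Qed.

Lemma bin_incr n i j : (i <= j <= n)%N -> ('C(2 * n, i) <= 'C(2 * n, j))%N.
Proof.
move=> /andP[+ +]; elim: j => [|j IH]; first by rewrite leqn0 => /eqP ->.
rewrite leq_eqVlt => /orP[/eqP ->//|ij] jn.
by apply: leq_trans (IH _ _) (bin_step_up _); lia.
Qed.

Lemma bin_decr n i j : (n <= i <= j)%N -> ('C(2 * n, j) <= 'C(2 * n, i))%N.
Proof.
move=> /andP[+ +]; elim: j => [|j IH ni]; first by move=> + /[!leqn0] /eqP ->.
rewrite leq_eqVlt => /orP[/eqP ->//|ij].
by apply: leq_trans (bin_step_down _) (IH _ _); lia.
Qed.

(** The induction step amounts to (2n + 1)(2n + 3) <= (2n + 2)^2. *)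
Lemma central_bin_sqr n : ((2 * n).+1 * 'C(2 * n, n) ^ 2 <= 16 ^ n)%N.
Proof.
elim: n => [//|n IH].
have e1 : (2 * n.+1 * 'C((2 * n).+1, n) = n.+1 * 'C(2 * n.+1, n.+1))%N.
  by rewrite -mul_bin_diag; congr (_ * 'C(_, _))%N; lia.
have e2 : ((2 * n).+1 * 'C(2 * n, n) = n.+1 * 'C((2 * n).+1, n))%N.
  by rewrite (mul_bin_down (2 * n).+1 n); congr (_ * _)%N; lia.
move: IH e1 e2; set C := 'C(2 * n, n); set C1 := 'C((2 * n).+1, n).
set C2 := 'C(2 * n.+1, n.+1) => IH e1 e2.
have e : (n.+1 * C2 = 2 * ((2 * n).+1 * C))%N by lia.
rewrite -(leq_pmul2l (m := n.+1 ^ 2))//.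
have -> : (n.+1 ^ 2 * ((2 * n.+1).+1 * C2 ^ 2) = (2 * n.+1).+1 * (n.+1 * C2) ^ 2)%N.
  by rewrite expnMn; lia.
rewrite e (_ : _ * _ = 4 * (2 * n.+1).+1 * (2 * n).+1 * ((2 * n).+1 * C ^ 2))%N; last first.
  by rewrite !expnMn; lia.
apply: leq_trans (leq_mul (leqnn _) IH) _.
rewrite [(16 ^ n.+1)%N]expnS mulnA leq_mul2r; apply/orP; right; lia.
Qed.

(** The bound of order 1 / sqrt(j) for j = 4^q tosses of a coin. *)
Lemma central_bin_le q : (0 < q)%N ->
  ('C(4 ^ q, 4 ^ q %/ 2) * 2 ^ q <= 2 ^ (4 ^ q))%N.
Proof.
move=> q0; have e : (4 ^ q = 2 * (4 ^ q %/ 2))%N.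
  by case: q q0 => // q _; rewrite expnS; lia.
rewrite -leq_sqr expnMn -!expnM [(q * 2)%N]mulnC expnM -[(2 ^ 2)%N]/4%N.
rewrite {1 3 4}e; set n := (4 ^ q %/ 2)%N.
rewrite mulnC; apply: leq_trans (_ : ((2 * n).+1 * 'C(2 * n, n) ^ 2 <= _)%N).
  by rewrite leq_mul2r leqnSn orbT.
apply: leq_trans (central_bin_sqr n) _.
by rewrite -[16%N]/(2 ^ 4)%N -expnM leq_exp2l//; lia.
Qed.

Lemma sum_bin j b : (\sum_(0 <= i < b) 'C(j, i) <= 2 ^ j)%N.
Proof.
have -> : (2 ^ j = \sum_(0 <= i < j.+1) 'C(j, i))%N.
  rewrite -[2%N]/(1 + 1)%N Pascal big_mkord; apply: eq_bigr => i _.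
  by rewrite !exp1n !muln1.
case: (leqP b j.+1) => bj; first exact: sum_prefix_le.
rewrite (@big_cat_nat _ _ _ j.+1)//=; last by rewrite ltnW.
rewrite [X in (_ + X)%N]big_nat_cond [X in (_ + X)%N]big1 ?addn0//.
by move=> i; rewrite andbT => /andP[ji _]; rewrite bin_small.
Qed.

(** The number of heads in [2 * n] tosses modulo [m]: a fluctuating part,
bounded by the central binomial coefficient, and an equidistributed part. *)
Lemma sum_bin_residue n m w v : (0 < m)%N -> (v < m)%N ->
  (m * \sum_(0 <= i < (2 * n).+1 | ((i + v) %% m < w)%N) 'C(2 * n, i) <=
   w * (2 * m * 'C(2 * n, n) + 2 ^ (2 * n)))%N.
Proof.
(* The coefficients are shifted by [v]; the residue classes become
   progressions from [c < w] and the peak moves to [v + n]. *)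
move=> m0 vm; pose f x := (if (v <= x)%N then 'C(2 * n, x - v) else 0)%N.
pose N := (2 * n + 2)%N.
have fle c : (m * \sum_(0 <= k < N) f (c + k * m) <= 2 * m * 'C(2 * n, n) + 2 ^ (2 * n))%N.
  have := @unimodal_progression f (v + n) _ _ c m N.
  rewrite /f leq_addr addKn => /(_ _ _)/leq_trans; apply.
  - move=> i j ij; case: (leqP v i) => // vi; rewrite (_ : (v <= j)%N); last by lia.
    by apply: bin_incr; lia.
  - move=> i j ij; have vi : (v <= i)%N by lia.
    have -> : (v <= j)%N by lia.
    rewrite vi.
    by apply: bin_decr; lia.
  rewrite leq_add2l; set b := (c + _)%N.
  case: (leqP b v) => bv.
    rewrite big_nat_cond big1// => i; rewrite andbT => hi; rewrite ifF//; lia.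
  rewrite (@big_cat_nat _ _ _ v)//=; last exact: ltnW.
  rewrite [X in (X + _)%N]big_nat_cond big1 ?add0n; last first.
    by move=> i; rewrite andbT => hi; rewrite ifF//; lia.
  rewrite -{1}(add0n v) big_addn; apply: leq_trans (sum_bin _ (b - v)).
  by apply: leq_sum => i _; rewrite leq_addl addnK.
have {fle} fle : (m * \sum_(0 <= c < w) \sum_(0 <= k < N) f (c + k * m) <=
    w * (2 * m * 'C(2 * n, n) + 2 ^ (2 * n)))%N.
  rewrite big_distrr /= -{2}(subn0 w) -sum_nat_const_nat.
  by apply: leq_sum => c _; exact: fle.
apply: leq_trans fle; rewrite leq_mul2l; apply/orP; right.
apply: (@leq_trans (\sum_(0 <= i < (2 * n).+1) \sum_(0 <= c < w)
    \sum_(0 <= k < N) (i + v == c + k * m) * f (c + k * m))%N).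
  rewrite big_mkcond; rewrite [leqLHS]big_nat_cond [leqRHS]big_nat_cond.
  apply: leq_sum => i; rewrite andbT => /andP[_ iN]; case: ifP => // hw.
  rewrite (bigD1_seq ((i + v) %% m)%N) ?iota_uniq ?mem_index_iota//=.
  rewrite (bigD1_seq ((i + v) %/ m)%N) ?iota_uniq//=; last first.
    rewrite mem_index_iota /N /= ltn_divLR//; nia.
  have -> : ((i + v) %% m + (i + v) %/ m * m = i + v)%N by rewrite addnC -divn_eq.
  rewrite eqxx mul1n /f leq_addl addnK -addnA leq_addr//.
rewrite exchange_big /=; apply: leq_sum => c _.
rewrite exchange_big /=; apply: leq_sum => k _.
rewrite -big_distrl /= -[leqRHS]mul1n leq_mul2r; apply/orP; right.
have -> : forall y b, (\sum_(0 <= i < b) (i + v == y) = (v <= y < b + v) :> nat)%N.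
  move=> y; elim=> [|b IH]; first by rewrite big_nil; lia.
  by rewrite big_nat_recr//= IH; lia.
exact: leq_b1.
Qed.

(** * The walk on the line modulo a period *)

(** A walk with steps 1 and -1 keeps its parity, so that a window of residues
for its position is a window of half the size for its number of up-steps. *)
Lemma window_halve (u : int) (i m w : nat) : (0 < m)%N ->
  ((u + (2 * i)%N) %% (2 * m)%N)%Z < (2 * w)%N ->
  ((i + `|((u %/ 2)%Z %% m)%Z|) %% m < w)%N.
Proof.
move=> m0; pose y := (u %/ 2)%Z + i%:Z.
have -> : ((i + `|((u %/ 2)%Z %% m)%Z|) %% m)%N = `|(y %% m)%Z|%N.
  apply: (can_inj absz_nat) => /=.
  rewrite gez0_abs ?modz_ge0//; last by lia.
  rewrite -modz_nat PoszD gez0_abs ?modz_ge0 ?modzDmr//; last by lia.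
  by rewrite addrC.
have by' := divz_bounds y m0; have bu := divz_bounds u (isT : (0 < 2)%N).
have my : (y %% m)%Z = y - (y %/ m)%Z * m.
  by rewrite {2}(divz_eq y m) addrAC subrr add0r.
rewrite -my in by'.
have -> : u + (2 * i)%N = (y %/ m)%Z * (2 * m)%N + (2 * (y %% m)%Z + (u - (u %/ 2)%Z * 2)).
  by rewrite my /y; lia.
rewrite modzMDl modz_small; last by lia.
by move=> h; rewrite -ltz_nat gez0_abs; lia.
Qed.

Section Heat.
Context {R : realType}.
Implicit Types h : int -> R.

(** The expectation of [h] at time [j] for the walk on the line started at
[a]. *)
Fixpoint heat j h (a : int) : R :=
  if j is j'.+1 then 2^-1 * (heat j' h (a + 1) + heat j' h (a - 1)) else h a.

Lemma heat_le j h h' a : (forall a, h a <= h' a) -> heat j h a <= heat j h' a.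
Proof.
move=> hh; elim: j a => [//|j IH] a /=.
by rewrite ler_wpM2l ?invr_ge0// lerD.
Qed.

(** Averaging does not increase suprema: bounds at one time persist. *)
Lemma heat_sup j j' h (b : R) : (j <= j')%N -> (forall a, heat j h a <= b) ->
  forall a, heat j' h a <= b.
Proof.
move=> /subnK <- hb; elim: (j' - j)%N => [//|d IH] a.
rewrite addSn /= ler_pdivrMl//; have := IH (a + 1); have := IH (a - 1); lra.
Qed.

Lemma heat_ge0 j h a : (forall a, 0 <= h a) -> 0 <= heat j h a.
Proof.
move=> h0; elim: j a => [//|j IH] a /=.
by rewrite mulr_ge0 ?invr_ge0// addr_ge0.
Qed.

Lemma heat_bin j h a : 2 ^+ j * heat j h a =
  \sum_(i < j.+1) 'C(j, i)%:R * h (a + (2 * i)%N%:Z - j%:Z).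
Proof.
elim: j a => [|j IH] a.
  by rewrite big_ord_recl big_ord0 /= expr0 bin0 !mul1r !addr0.
rewrite exprS [heat _ _ _]/= mulrACA divff ?pnatr_eq0// mul1r mulrDr !IH.
rewrite [RHS]big_ord_recl /= bin0.
under [in RHS]eq_bigr do rewrite /bump /= add1n binS natrD mulrDl.
rewrite big_split [RHS]addrA [RHS]addrC; congr (_ + _).
  by apply: eq_bigr => i _; congr (_ * h _); rewrite mulnS; lia.
rewrite [in LHS]big_ord_recl [X in _ = _ + X]big_ord_recr /= bin0 bin_small//.
rewrite mul0r addr0; congr (_ * h _ + _); first lia.
rewrite addr0; apply: eq_bigr => i _; rewrite /bump /= add1n.
by congr (_ * h _); rewrite mulnS; lia.
Qed.

Definition window_ind (m w : nat) (s a : int) : R :=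
  (((a + s) %% m)%Z < w%:Z)%R%:R.

(** A label is met with probability of order 2^-i at time 4^(l + i), l being
[side_exp n]: the walk has then spread over 2^i intervals of length 2^l. For
[i] up to [label_exp n] the equidistributed part of [sum_bin_residue] is not
larger than the fluctuating one. *)
Lemma heat_window n i s a : (i <= label_exp n)%N ->
  heat (4 ^ (side_exp n + i)) (window_ind (2 ^ level n) (2 * side n) s) a
    <= 4 / 2 ^+ i.
Proof.
move=> ik; set q := (side_exp n + i)%N; set J := (4 ^ q)%N.
pose m := (2 ^ (level n).-1)%N.
have q0 : (0 < q)%N by rewrite addn_gt0 expn_gt0.
have lev0 : (0 < level n)%N by rewrite addn_gt0 expn_gt0.
have em : (2 ^ level n = 2 * m)%N by rewrite -expnS prednK.
have m0 : (0 < m)%N by rewrite expn_gt0.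
have eJ : (J = 2 * (J %/ 2))%N.
  by rewrite /J; case: q q0 {J} => // q _; rewrite expnS; lia.
set M := (J %/ 2)%N in eJ.
pose u := a - J%:Z + s; pose v := `|((u %/ 2)%Z %% m)%Z|%N.
have vm : (v < m)%N.
  by rewrite -ltz_nat /v gez0_abs ?modz_ge0 ?ltz_pmod//; lia.
pose S := (\sum_(0 <= x < (2 * M).+1 | ((x + v) %% m < side n)%N) 'C(2 * M, x))%N.
have S1 : (m * S <= side n * (2 * m * 'C(2 * M, M) + 2 ^ (2 * M)))%N.
  exact: sum_bin_residue.
have S2 : (S * 2 ^ i <= 4 * 2 ^ J)%N.
  have cb := central_bin_le q0; rewrite -/J -/M {1}eJ in cb.
  have mi : (side n * 2 ^ i <= 2 * m)%N.
    by rewrite -em -expnD leq_exp2l// leq_add2l.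
  rewrite -(leq_pmul2l m0) mulnA.
  apply: leq_trans (leq_mul S1 (leqnn _)) _.
  rewrite -eJ -(leq_pmul2l (side_gt0 n)).
  have c2 : (side n * (side n * (2 * m * 'C(J, M) + 2 ^ J) * 2 ^ i) =
     side n * (2 * m * ('C(J, M) * 2 ^ q) + side n * 2 ^ i * 2 ^ J))%N.
    rewrite /q expnD -/(side n); lia.
  rewrite c2 leq_mul2l; apply/orP; right.
  apply: (@leq_trans (2 * m * 2 ^ J + 2 * m * 2 ^ J)); last by lia.
  by apply: leq_add; [rewrite leq_mul2l {1}eJ cb orbT|rewrite leq_mul2r mi orbT].
rewrite ler_pdivlMr ?exprn_gt0// -(@ler_pM2l _ (2 ^+ J)) ?exprn_gt0//.
rewrite mulrA heat_bin.
apply: (@le_trans _ _ (S%:R * 2 ^+ i)); last first.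
  by rewrite -!natrX -!natrM ler_nat mulnC [leqRHS]mulnC mulnC.
have -> : S = (\sum_(x < J.+1) if (x + v) %% m < side n then 'C(J, x) else 0)%N.
  by rewrite /S -eJ big_mkcond big_mkord.
rewrite ler_wpM2r ?exprn_ge0// natr_sum.
apply: ler_sum => x _; rewrite /window_ind.
have -> : a + (2 * x)%N%:Z - J%:Z + s = u + (2 * x)%N by rewrite /u; lia.
rewrite em; case: ifP => hx; first by rewrite ler_piMr// lern1 leq_b1.
by case: ltP => [/(window_halve m0)|_]; rewrite ?mulr0// -/v hx.
Qed.

(** The probability, in one coordinate, that the next edge has label [c]. *)
Definition corner_prob (ph : nat -> int) n (c : nat) (a : int) : R :=
  2^-1 * ((lab1 ph n (low1 true a) == c)%:R + (lab1 ph n (low1 false a) == c)%:R).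

Lemma corner_prob_ge0 ph n c a : 0 <= corner_prob ph n c a.
Proof. by rewrite mulr_ge0 ?invr_ge0// addr_ge0. Qed.

Lemma corner_prob_le1 ph n c a : corner_prob ph n c a <= 1.
Proof.
by rewrite /corner_prob; case: (_ == _); case: (_ == _) => /=; lra.
Qed.

(** The window has twice the size of an interval, since an edge has label [c]
when its lower end, [a] or [a - 1], is in the interval. *)
Lemma corner_prob_window ph n c : exists s, forall a,
  corner_prob ph n c a <= window_ind (2 ^ level n) (2 * side n) s a.
Proof.
have [s sP] := lab1_residue ph n c; exists s => a; rewrite /window_ind.
have L0 := side_gt0 n; have K2 := nlabels_gt1 n.
have LM : (2 * side n <= 2 ^ level n)%N by rewrite -period_level mulnC leq_mul2l K2 orbT.
case: ltP => [_|nw]; first exact: corner_prob_le1.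
have P0 : (0 < 2 ^ level n)%N by rewrite expn_gt0.
have e1 : (lab1 ph n a == c) = false.
  by apply/negP => /eqP/sP lt; move: nw; rewrite leNgt (lt_le_trans lt)// lez_nat leq_pmull.
suff e2 : (lab1 ph n (a - 1) == c) = false.
  by rewrite /corner_prob /= e1 e2 addr0 mulr0.
apply/negP => /eqP/sP lt; have b := divz_bounds (a - 1 + s) P0.
set Q := ((a - 1 + s) %/ _)%Z in b.
have r_eq : ((a - 1 + s) %% (2 ^ level n)%N)%Z = (a - 1 + s) - Q * (2 ^ level n)%N.
  apply/esym/eqP; rewrite subr_eq [X in _ == X]addrC; apply/eqP; exact: divz_eq.
rewrite r_eq in lt; move: nw; apply/negP; rewrite -ltNge.
have -> : a + s = Q * (2 ^ level n)%N + ((a - 1 + s - Q * (2 ^ level n)%N) + 1) by lia.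
by rewrite modzMDl modz_small; lia.
Qed.

Lemma heat_corner ph n c i j a : (i <= label_exp n)%N ->
  (4 ^ (side_exp n + i) <= j)%N ->
  heat j (corner_prob ph n c) a <= 4 / 2 ^+ i.
Proof.
move=> ik ij; have [s sP] := corner_prob_window ph n c.
apply: le_trans (heat_le _ _ sP) _; apply: heat_sup ij _ _ => b.
exact: heat_window.
Qed.

Lemma heat_corner_le1 ph n c j a : heat j (corner_prob ph n c) a <= 1.
Proof.
by apply: (@heat_sup 0) => // b; exact: corner_prob_le1.
Qed.

End Heat.

(** * Expected displacement *)

Definition visits ph n c z p : nat :=
  count (fun e => lab2 ph n e == c) (corners z p).

Lemma visits_cons ph n c z g p : visits ph n c z (g :: p) =
  ((lab2 ph n (corner z g) == c) + visits ph n c (move z g) p)%N.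
Proof. by []. Qed.

Section Expected.
Context {R : realType}.
Notation E := (@wexp R dir).

Lemma sum_dir (F : dir -> R) : \sum_(g : dir) F g =
  F (true, true, true) + F (true, true, false) +
  (F (true, false, true) + F (true, false, false)) +
  (F (false, true, true) + F (false, true, false) +
   (F (false, false, true) + F (false, false, false))).
Proof.
rewrite (eq_bigr (fun g => F (g.1, g.2))); last by case.
rewrite -(pair_bigA _ (fun x d => F (x, d))) /=.
rewrite (eq_bigr (fun x => \sum_(d : bool) F ((x.1, x.2), d))); last by case.
rewrite -(pair_bigA _ (fun s t => \sum_(d : bool) F ((s, t), d))) /=.
by rewrite !big_bool.
Qed.

(** The two coordinates of the walk are independent. *)
Lemma wexp_visits ph n c z m : E m (fun p => (visits ph n c z p)%:R) =
  \sum_(j < m) heat j (corner_prob ph.1 n c.1) z.1 *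
               heat j (corner_prob ph.2 n c.2) z.2.
Proof.
elim: m z => [|m IH] z; first by rewrite big_ord0.
have e8 : #|dir|%:R = 8 :> R by rewrite card_dir.
rewrite wexpS e8.
rewrite (eq_bigr (fun g => (lab2 ph n (corner z g) == c)%:R +
    \sum_(j < m) heat j (corner_prob ph.1 n c.1) (move z g).1 *
                 heat j (corner_prob ph.2 n c.2) (move z g).2)); last first.
  move=> g _; rewrite -IH -[X in X + _](wexp_cst (S := dir) _ m) ?card_dir//.
  by rewrite -wexpD; apply: eq_wexp => p _; rewrite visits_cons natrD.
rewrite big_split exchange_big mulrDr big_ord_recl; congr (_ + _).
  rewrite sum_dir /= /corner_prob /lab2 /corner /=.
  case: c {IH} => c1 c2; rewrite !xpair_eqE /=.
  by do 4! case: (_ == _) => /=; lra.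
rewrite mulr_sumr; apply: eq_bigr => j _; rewrite sum_dir /= /bump /=.
set a1 := heat _ _ (_ + _); set b1 := heat _ _ (_ + _).
by set a2 := heat _ _ _; set b2 := heat _ _ _; lra.
Qed.

(** The times between 4^(l + i) and 4^(l + i + 1), where l = [side_exp n], number
3 * 4^(l + i), and each counts for at most (4 / 2^i)^2: every such block adds
the same amount, whence the logarithm typical of dimension two. *)
Lemma sum_heat_le ph n c z i : (i <= label_exp n)%N ->
  \sum_(j < 4 ^ (side_exp n + i)) heat j (corner_prob ph.1 n c.1) z.1 *
               heat j (corner_prob ph.2 n c.2) z.2 <=
  4 ^+ (side_exp n) * (1 + 48 * i%:R) :> R.
Proof.
pose r j : R := heat j (corner_prob ph.1 n c.1) z.1 *
               heat j (corner_prob ph.2 n c.2) z.2.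
have r_le j (b : R) : heat j (corner_prob ph.1 n c.1) z.1 <= b ->
    heat j (corner_prob ph.2 n c.2) z.2 <= b -> r j <= b ^+ 2.
  move=> h1 h2; rewrite expr2; apply: ler_pM => //; apply: heat_ge0 => a;
    exact: corner_prob_ge0.
elim: i => [|i IH] ik.
  rewrite addn0 mulr0 addr0 mulr1 -natrX.
  apply: (@le_trans _ _ (\sum_(j < 4 ^ side_exp n) 1)).
    apply: ler_sum => j _; rewrite -(expr1n _ 2); apply: r_le; exact: heat_corner_le1.
  by rewrite sumr_const card_ord.
have {IH} IH := IH (ltnW ik); rewrite addnS; set J := (4 ^ (side_exp n + i))%N in IH *.
have eJ : (4 ^ (side_exp n + i).+1 = J + 3 * J)%N by rewrite expnS -/J; lia.
rewrite -(big_mkord xpredT r) -(big_mkord xpredT r) in IH *.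
rewrite (@big_cat_nat _ _ _ J)//=; last by rewrite eJ leq_addr.
rewrite -[i.+1%:R]natr1.
apply: (@le_trans _ _ (4 ^+ side_exp n * (1 + 48 * i%:R) + 4 ^+ side_exp n * 48));
  last first.
  by rewrite -mulrDr; lra.
apply: lerD => //; rewrite big_nat.
apply: (@le_trans _ _ (\sum_(J <= j < 4 ^ (side_exp n + i).+1) (4 / 2 ^+ i) ^+ 2)).
  rewrite [leRHS]big_nat; apply: ler_sum => j /andP[Jj _].
  by apply: r_le; apply: heat_corner => //; exact: ltnW.
rewrite sumr_const_nat eJ addKn -[_ *+ (3 * J)]mulr_natr natrM /J expnD natrM !natrX.
have -> : (4 : R) ^+ i = (2 ^+ i) ^+ 2.
  by rewrite -exprM mulnC exprM; congr (_ ^+ _); lra.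
have : (2 : R) ^+ i != 0 by rewrite expf_neq0// pnatr_eq0.
move: (2 ^+ i) (4 ^+ _) => x y x0.
have -> : (4 / x) ^+ 2 * (3 * (y * x ^+ 2)) = 16 * 3 * y * (x / x) ^+ 2.
  by rewrite !expr2; lra.
by rewrite divff// expr1n; lra.
Qed.

Definition visit_bound n : R := 4 ^+ side_exp n * (1 + 48 * (label_exp n)%:R).
Definition walk_time n : nat := (4 ^ level n)%N.

Lemma wexp_visits_le ph n c z m : (m <= walk_time n)%N ->
  E m (fun p => (visits ph n c z p)%:R) <= visit_bound n.
Proof.
move=> mT; rewrite wexp_visits; apply: le_trans (sum_heat_le ph c z (leqnn _)).
rewrite -/(walk_time n) (big_ord_widen _ (fun j => heat j (corner_prob ph.1 n c.1) z.1 *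
               heat j (corner_prob ph.2 n c.2) z.2) mT).
rewrite [leLHS]big_mkcond; apply: ler_sum => j _; case: ifP => // _.
by rewrite mulr_ge0//; apply: heat_ge0 => a; exact: corner_prob_ge0.
Qed.

Lemma visit_bound_ge0 n : 0 <= visit_bound n.
Proof. by rewrite mulr_ge0 ?exprn_ge0// addr_ge0// mulr_ge0. Qed.

(** The sum of the squares counts the pairs of times at which the labels
agree. Given the first of the two times, the number of later ones is a number
of visits, bounded by [visit_bound] from any position. *)
Lemma wexp_collisions_le ph n z m : (m <= walk_time n)%N ->
  E m (fun p => \sum_(c <- labels n) (visits ph n c z p)%:R ^+ 2) <=
  m%:R * (1 + 2 * visit_bound n).
Proof.
elim: m z => [|m IH] z mT.
  by rewrite mul0r /= big1// => c _; rewrite expr0n.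
have e8 : #|dir|%:R = 8 :> R by rewrite card_dir.
rewrite wexpS e8 ler_pdivrMl//.
apply: (@le_trans _ _ (\sum_(g : dir) ((m.+1)%:R * (1 + 2 * visit_bound n)))); last first.
  by rewrite sumr_const card_dir -[leLHS]mulr_natl.
apply: ler_sum => g _.
set e := lab2 ph n (corner z g).
rewrite (eq_wexp (h := fun p => (1 + 2 * (visits ph n e (move z g) p)%:R) +
    \sum_(c <- labels n) (visits ph n c (move z g) p)%:R ^+ 2)); last first.
  move=> p _; under eq_bigr do rewrite visits_cons -/e natrD sqrrD.
  rewrite !big_split /=; congr (_ + _); congr (_ + _).
    rewrite (bigD1_seq e) ?lab2_labels ?labels_uniq//= eqxx expr1n big1 ?addr0// => c.
    by rewrite eq_sym => /negbTE ->; rewrite expr0n.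
  rewrite (bigD1_seq e) ?lab2_labels ?labels_uniq//= eqxx mul1r big1 ?addr0.
    by rewrite mulr_natl.
  by move=> c; rewrite eq_sym => /negbTE ->; rewrite mul0r.
rewrite !wexpD wexpZ wexp_cst ?card_dir//.
have := wexp_visits_le ph e (move z g) (ltnW mT).
have := IH (move z g) (ltnW mT).
by rewrite -natr1; lra.
Qed.

(** Each crossing of label [c] comes with a fair coin which decides whether
the lamp is toggled, so one crossing suffices to make its state uniform. *)
Lemma wexp_toggled ph n c z m :
  E m (fun p => (toggled ph z p n c)%:R) =
  2^-1 * E m (fun p => (0 < visits ph n c z p)%N%:R).
Proof.
elim: m z => [|m IH] z; first by rewrite /= mulr0.
have e8 : #|dir|%:R = 8 :> R by rewrite card_dir.
rewrite !wexpS e8 !sum_dir.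
have pair s t : E m (fun p => (toggled ph z ((s, t, true) :: p) n c)%:R) +
    E m (fun p => (toggled ph z ((s, t, false) :: p) n c)%:R) =
    2^-1 * (E m (fun p => (0 < visits ph n c z ((s, t, true) :: p))%N%:R) +
            E m (fun p => (0 < visits ph n c z ((s, t, false) :: p))%N%:R)).
  have e d : corner z (s, t, d) = corner z (s, t, true) by [].
  have e' d : move z (s, t, d) = move z (s, t, true) by [].
  have vE d p : visits ph n c z ((s, t, d) :: p) =
     ((lab2 ph n (corner z (s, t, true)) == c) + visits ph n c (move z (s, t, true)) p)%N.
    by [].
  have tE d p : toggled ph z ((s, t, d) :: p) n c =
     (d && (lab2 ph n (corner z (s, t, true)) == c)) (+) toggled ph (move z (s, t, true)) p n c.
    by [].
  case: (boolP (lab2 ph n (corner z (s, t, true)) == c)) => ec.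
    have vp d : E m (fun p => (0 < visits ph n c z ((s, t, d) :: p))%N%:R) = 1.
      rewrite -[RHS](wexp_cst (S := dir) _ m) ?card_dir//.
      by apply: eq_wexp => p _; rewrite vE ec.
    rewrite !vp -wexpD (eq_wexp (h := fun=> 1)) ?wexp_cst ?card_dir//; first lra.
    by move=> p _; rewrite !tE ec; case: toggled; rewrite /= ?addr0 ?add0r.
  have vp d : E m (fun p => (0 < visits ph n c z ((s, t, d) :: p))%N%:R) =
      E m (fun p => (0 < visits ph n c (move z (s, t, true)) p)%N%:R).
    by apply: eq_wexp => p _; rewrite vE (negbTE ec).
  have tp d : E m (fun p => (toggled ph z ((s, t, d) :: p) n c)%:R) =
      E m (fun p => (toggled ph (move z (s, t, true)) p n c)%:R).
    by apply: eq_wexp => p _; rewrite tE (negbTE ec) andbF.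
  by rewrite !vp !tp !IH; lra.
by rewrite !pair; lra.
Qed.

Lemma sum_visits ph n z p :
  \sum_(c <- labels n) (visits ph n c z p)%:R = (size p)%:R :> R.
Proof.
elim: p z => [|g p IH] z; first by rewrite big1.
under eq_bigr do rewrite visits_cons natrD.
rewrite big_split /= IH (bigD1_seq (lab2 ph n (corner z g))) ?lab2_labels ?labels_uniq//=.
rewrite eqxx big1 ?addr0 ?nat1r// => c.
by rewrite eq_sym => /negbTE ->.
Qed.

(** The second moment method, in the form 1[N > 0] >= 2 l N - l^2 N^2 for the
number N of visits to a label. Summed over the labels, the first term gives the
length of the walk and the second the collisions; [l] is the optimal
constant. *)
Lemma wexp_lit_ge ph n z :
  (4 ^+ label_exp n) / (198 * (label_exp n)%:R) <=
  E (walk_time n) (fun p => (lit ph n z p)%:R).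
Proof.
set T := walk_time n; set V := visit_bound n.
have V0 : 0 <= V := visit_bound_ge0 n.
have D0 : 0 < 1 + 2 * V by lra.
pose l := (1 + 2 * V)^-1.
have l0 : 0 < l by rewrite invr_gt0.
rewrite (eq_wexp (h := fun p => \sum_(c <- labels n) (toggled ph z p n c)%:R)); last first.
  move=> p _; rewrite /lit -sum1_count natr_sum big_mkcond.
  by apply: eq_bigr => c _; case: toggled.
rewrite wexp_sum (eq_bigr _ (fun c _ => wexp_toggled ph n c z T)) -mulr_sumr -wexp_sum.
have range_ge : E T (fun p => 2 * l * (size p)%:R +
      (- l ^+ 2) * \sum_(c <- labels n) (visits ph n c z p)%:R ^+ 2) <=
    E T (fun p => \sum_(c <- labels n) (0 < visits ph n c z p)%N%:R).
  apply: le_wexp => p _; rewrite -(sum_visits ph n z p) !mulr_sumr -big_split /=.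
  apply: ler_sum => c _; case: (visits _ _ _ _ _) => [|v].
    by rewrite expr0n /= !mulr0 addr0.
  have := sqr_ge0 (1 - l * v.+1%:R); rewrite /=; lra.
have coll := wexp_collisions_le ph z (leqnn T).
rewrite wexpD !wexpZ in range_ge.
rewrite (eq_wexp (h := fun=> T%:R)) in range_ge; last by move=> p ->.
rewrite wexp_cst ?card_dir// in range_ge.
have low : T%:R * l <= E T (fun p => \sum_(c <- labels n) (0 < visits ph n c z p)%N%:R).
  apply: le_trans range_ge.
  have : l ^+ 2 * E T (fun p => \sum_(c <- labels n) (visits ph n c z p)%:R ^+ 2) <=
      l ^+ 2 * (T%:R * (1 + 2 * V)) by rewrite ler_wpM2l// exprn_ge0// ltW.
  have -> : l ^+ 2 * (T%:R * (1 + 2 * V)) = T%:R * l * (l * (1 + 2 * V)) by lra.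
  by rewrite {3}/l mulVf ?gt_eqF// mulr1; lra.
apply: le_trans (_ : 2^-1 * (T%:R * l) <= _); last by rewrite ler_wpM2l// invr_ge0.
have k1 : 1 <= (label_exp n)%:R :> R by rewrite ler1n.
have s0 : 1 <= 4 ^+ side_exp n :> R by rewrite exprn_ege1// ler1n.
rewrite /l mulrA ler_pdivrMr; last by lra.
rewrite mulrAC ler_pdivlMr//.
rewrite /T /walk_time natrX exprD /V /visit_bound.
have : 0 <= 4 ^+ label_exp n :> R by rewrite exprn_ge0.
move: (4 ^+ label_exp n) (4 ^+ side_exp n) s0 => x y s0 x0.
have -> : 2^-1 * (y * x) * (198 * (label_exp n)%:R) = x * (99 * (y * (label_exp n)%:R)) by lra.
rewrite ler_wpM2l//.
(* 1 + 2 y (1 + 48 k) <= 99 y k because y and k are at least 1. *)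
have : 0 <= (y - 1) * ((label_exp n)%:R - 1) by rewrite mulr_ge0// subr_ge0.
lra.
Qed.

(** The first moment of the distance is bounded below by [lit_gdist] and
[wexp_lit_ge]; the constant is 1782 = 9 * 198. *)
Lemma mean_sq_displacement_ge ph n z :
  1782 * (label_exp n)%:R <= 4 ^+ label_exp n :> R ->
  ((side n)%:R * (4 ^+ label_exp n / (1782 * (label_exp n)%:R) - 1)) ^+ 2 <=
  srw_expect (lamp_vtx ph z [::]) (walk_time n)
    (fun y => (gdist (lamp_vtx ph z [::]) y)%:R ^+ 2) :> R.
Proof.
move=> big; rewrite /lamp_vtx srw_expect_vtx ?card_dir//; last exact: step_inj.
rewrite -/(lamp_vtx ph z [::]).
apply: le_trans (sqr_wexp_le _ _ _); last by rewrite card_dir.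
have k1 : 1 <= (label_exp n)%:R :> R by rewrite ler1n.
have L0 : 0 < (side n)%:R :> R by rewrite ltr0n side_gt0.
have D0 : 0 < 1782 * (label_exp n)%:R :> R by lra.
have base0 : 0 <= (side n)%:R * (4 ^+ label_exp n / (1782 * (label_exp n)%:R) - 1) :> R.
  apply: mulr_ge0; first exact: ltW.
  by rewrite subr_ge0 (ler_pdivlMr _ _ D0) mul1r.
rewrite ler_pXn2r ?nnegrE//.
  apply: (@le_trans _ _ (E (walk_time n) (fun p =>
      (side n)%:R / 9 * (lit ph n z p)%:R + - (side n)%:R))).
    rewrite wexpD wexpZ wexp_cst ?card_dir//.
    have := @wexp_lit_ge ph n z; rewrite -(ler_pM2l (_ : 0 < (side n)%:R / 9)); last first.
      by rewrite divr_gt0.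
    rewrite -[1782](_ : 198 * 9 = _ :> R) ?invfM; last by rewrite -natrM.
    by lra.
  apply: le_wexp => p _.
  have := lit_gdist ph n z p; rewrite /= -/(lamp_vtx ph z p).
  set d := gdist _ _ => hl.
  have hd : (d %/ side n * side n <= d)%N by exact: leq_trunc_div.
  rewrite -(ler_nat R) natrM in hd; rewrite -(ler_nat R) natrM -natr1 in hl.
  have := ler_wpM2l (ltW L0) hl; lra.
rewrite -(wexp_cst (S := dir) _ (walk_time n) 0) ?card_dir//.
by apply: le_wexp.
Qed.

End Expected.

(** * Polynomial growth *)

Lemma endpt_near z (p : seq dir) :
  (z.1 - (size p)%:Z <= (endpt z p).1 <= z.1 + (size p)%:Z) /\
  (z.2 - (size p)%:Z <= (endpt z p).2 <= z.2 + (size p)%:Z).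
Proof.
elim: p z => [|g p IH] z; first by rewrite /=; split; lia.
have := IH (move z g); rewrite [endpt z _]/=; case: g => -[s t] d.
rewrite [size _]/= /move /move1 /=.
by case: s; case: t => -[]; split; lia.
Qed.

Lemma toggled_labels ph z p n c : toggled ph z p n c -> c \in labels n.
Proof. by move=> /toggled_corner[e _ <-]; exact: lab2_labels. Qed.

Lemma leq_card_fset_set_inj (T : choiceType) (F : finType) (A : set T) (f : T -> F) :
  finite_set A -> {in A &, injective f} -> (#|` fset_set A| <= #|F|)%N.
Proof.
move=> finA finj.
have : uniq [seq f x | x <- fset_set A].
  rewrite map_inj_in_uniq ?fset_uniq// => x y xA yA.
  by apply: finj; rewrite -in_fset_set.
move/card_uniqP; rewrite size_map => <-; exact: max_card.
Qed.

Lemma offset_inj (a a' b : int) (m m' k : nat) : (m <= k)%N -> (m' <= k)%N ->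
  b - m%:Z <= a <= b + m%:Z -> b - m'%:Z <= a' <= b + m'%:Z ->
  inord `|(a - b + k%:Z)%R|%N = inord `|(a' - b + k%:Z)%R|%N :> 'I_(2 * k).+1 ->
  a = a'.
Proof.
move=> mk mk' ha ha' /(congr1 val) /=.
have h1 : (`|(a - b + k%:Z)%R| < (2 * k).+1)%N by lia.
have h2 : (`|(a' - b + k%:Z)%R| < (2 * k).+1)%N by lia.
by rewrite !inordK//; lia.
Qed.

Section BallCard.
Variables (ph : phases) (z : int * int).
Hypotheses (coh1 : coherent ph.1) (coh2 : coherent ph.2).

Let lamp_index N : finType := {n : 'I_N.+1 & ('I_(nlabels n) * 'I_(nlabels n))%type}.
Let code N k : finType := ('I_(2 * k).+1 * 'I_(2 * k).+1 * {ffun lamp_index N -> bool})%type.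

Lemma card_lamp_code N k : #|code N k| =
  ((2 * k).+1 * (2 * k).+1 * 2 ^ (\sum_(n < N.+1) nlabels n ^ 2))%N.
Proof.
rewrite !card_prod !card_ord card_ffun card_bool card_tagged sumnE big_map.
congr (_ * 2 ^ _)%N; rewrite big_enum /=; apply: eq_bigr => n _.
by rewrite card_prod !card_ord expnS expn1.
Qed.

(** A vertex of the ball is encoded by its position and the lamps of scales
at most [N]: [toggled_determined] recovers the other lamps. *)
Lemma gball_lamp_card (R : numDomainType) (x : vertex (lamp_graph ph z)) (r : R) k N :
  (forall m : nat, m%:R <= r -> (m <= k)%N) -> (2 * k <= side N)%N ->
  (#|` fset_set (gball x r)| <=
    (2 * k).+1 * (2 * k).+1 * 2 ^ (\sum_(n < N.+1) nlabels n ^ 2))%N.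
Proof.
move=> rk kN; have [u ->] : exists u, x = lamp_vtx ph z u by exact: vtx_surj.
rewrite -(card_lamp_code N k).
have ballP y : gball (lamp_vtx ph z u) r y ->
    exists p, (size p <= k)%N /\ y = lamp_vtx ph z (u ++ p).
  by move=> /gball_vtx[p [/rk pk ->]]; exists p.
pose word y := xget [::] [set p | (size p <= k)%N /\ y = lamp_vtx ph z (u ++ p)].
have wordP y : gball (lamp_vtx ph z u) r y ->
    (size (word y) <= k)%N /\ y = lamp_vtx ph z (u ++ word y).
  by move=> /ballP/(xgetPex [::]).
pose zu := endpt z u.
pose code_of (p : seq dir) : code N k :=
  (inord `|((endpt zu p).1 - zu.1 + k%:Z)%R|%N, inord `|((endpt zu p).2 - zu.2 + k%:Z)%R|%N,
   [ffun i : lamp_index N => toggled ph zu p (tag i) (val (tagged i).1, val (tagged i).2)]).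
apply: (@leq_card_fset_set_inj _ _ _ (code_of \o word)).
  apply: (@sub_finite_set _ _ (range (fun t : k.-bseq dir => lamp_vtx ph z (u ++ t)))).
    move=> y /ballP[p [pk ->]]; by exists (Bseq pk).
  by apply: finite_image; exact: finite_finset.
move=> y y' /set_mem/wordP[sp ey] /set_mem/wordP[sq ey'] /=.
suff code_inj p q : (size p <= k)%N -> (size q <= k)%N -> code_of p = code_of q ->
    lamp_vtx ph z (u ++ p) = lamp_vtx ph z (u ++ q).
  by move=> e; rewrite ey ey'; exact: code_inj.
move=> {y y' sp ey sq ey'} pk qk [e1 e2 /ffunP eq_code].
have [[p1 p2] [q1 q2]] := (endpt_near zu p, endpt_near zu q).
have ends : endpt zu p = endpt zu q.
  rewrite [LHS]surjective_pairing [RHS]surjective_pairing.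
  by rewrite (offset_inj pk qk p1 q1 e1) (offset_inj pk qk p2 q2 e2).
have low n c : (n <= N)%N -> toggled ph zu p n c = toggled ph zu q n c.
  move=> nN; case: (boolP (c \in labels n)) => [|cn].
    case/allpairsP => -[a b] /= []; rewrite !mem_iota /= !add0n => an bn ->.
    pose n' : 'I_N.+1 := @Ordinal N.+1 n nN.
    pose i : 'I_(nlabels n') := @Ordinal (nlabels n) a an.
    pose j : 'I_(nlabels n') := @Ordinal (nlabels n) b bn.
    have := eq_code (existT (fun n : 'I_N.+1 => ('I_(nlabels n) * 'I_(nlabels n))%type) n' (i, j)).
    by rewrite !ffunE.
  have off r' : toggled ph zu r' n c = false.
    by apply/negP => /toggled_labels; apply/negP.
  by rewrite !off.
apply/eq_vtx/run_dark_eq; rewrite !endpt_cat; split; first exact: ends.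
move=> n c; rewrite !toggled_cat; congr (_ (+) _).
case: (leqP n N) => nN; first exact: low.
by apply: (toggled_determined coh1 coh2 (ltnW nN) kN pk qk) => c'; exact: low.
Qed.

Lemma sum_nlabels_sqr N : (\sum_(n < N.+1) nlabels n ^ 2 <= 2 * 4 ^ N.+1)%N.
Proof.
have e n : (nlabels n ^ 2 = 4 ^ n.+1)%N by rewrite /nlabels /label_exp -expnM mulnC expnM.
elim: N => [|N IH]; first by rewrite big_ord_recl big_ord0 e.
rewrite big_ord_recr; apply: leq_trans (leq_add IH (leqnn _)) _.
by rewrite e [(4 ^ N.+2)%N]expnS; lia.
Qed.

(** With [N] minimal, [side N.-1 < 2 * k], and the lamps of scales at most [N]
number at most 8 times the binary logarithm of [side N.-1]. *)
Lemma gball_lamp_growth (R : numDomainType) (x : vertex (lamp_graph ph z)) (r : R) k :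
  (0 < k)%N -> (forall m : nat, m%:R <= r -> (m <= k)%N) ->
  (#|` fset_set (gball x r)| <= 9 * 2 ^ 12 * k ^ 10)%N.
Proof.
move=> k0 rk.
case: (ex_minnP (side_unbounded (2 * k))) => N kN Nmin.
apply: leq_trans (gball_lamp_card _ rk kN) _.
have codes : (2 ^ (\sum_(n < N.+1) nlabels n ^ 2) <= 16 * (2 * k) ^ 8)%N.
  (* For [N = 0] there are just four lamps, which accounts for the factor 16. *)
  case: N kN Nmin => [|N] kN Nmin.
    rewrite big_ord_recl big_ord0 addn0; apply: (@leq_trans (2 ^ 4)%N) => //.
    by rewrite -[X in (X <= _)%N]muln1 leq_mul// expn_gt0; lia.
  have sN : (side N < 2 * k)%N.
    by rewrite ltnNge; apply/negP => /Nmin; rewrite ltnn.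
  apply: (@leq_trans (2 ^ (8 * side_exp N))%N).
    rewrite leq_exp2l//; apply: leq_trans (sum_nlabels_sqr _) _.
    by rewrite /side_exp [(4 ^ N.+2)%N]expnS; lia.
  rewrite mulnC expnM -/(side N); apply: (@leq_trans ((2 * k) ^ 8)%N).
    by rewrite leq_exp2r// ltnW.
  by rewrite leq_pmull.
have k3 : ((2 * k).+1 <= 3 * k)%N by lia.
apply: (@leq_trans ((3 * k) * (3 * k) * (16 * (2 * k) ^ 8))%N).
  by apply: leq_mul codes; exact: leq_mul.
rewrite expnMn [(k ^ 10)%N](_ : _ = (k * k * k ^ 8)%N); last by rewrite -mulnA -!expnS.
rewrite (_ : 2 ^ 12 = 16 * 2 ^ 8)%N; last by rewrite (expnD 2 4 8).
by move: (2 ^ 8)%N (k ^ 8)%N => a b; lia.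
Qed.

End BallCard.

(** * Events that depend on finitely many binary digits *)

Definition coherent2 (ph : phases) : Prop := coherent ph.1 /\ coherent ph.2.

(** Seen from [z] and [z'], the phases have the same first [m] binary digits,
hence the same labels at every scale [n] with [level n <= m]. *)
Definition same_phase m (ph : phases) (z : int * int) (ph' : phases) (z' : int * int) : Prop :=
  (exists t : int, ph.1 m + z.1 = ph'.1 m + z'.1 + t * (2 ^ m)%N) /\
  (exists t : int, ph.2 m + z.2 = ph'.2 m + z'.2 + t * (2 ^ m)%N).

Lemma same_phase_sym m ph z ph' z' :
  same_phase m ph z ph' z' -> same_phase m ph' z' ph z.
Proof. by move=> [[t e] [t' e']]; split; [exists (- t)|exists (- t')]; lia. Qed.

Lemma coherent_shift (f f' : nat -> int) (a a' : int) m n :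
  coherent f -> coherent f' -> (m <= n)%N ->
  (exists t : int, f n + a = f' n + a' + t * (2 ^ n)%N) ->
  exists t : int, f m + a = f' m + a' + t * (2 ^ m)%N.
Proof.
move=> cf cf' mn [t e]; have [s es] := cf _ _ mn; have [s' es'] := cf' _ _ mn.
exists (t * (2 ^ (n - m))%N + s' - s).
have e2 : (2 ^ n = 2 ^ (n - m) * 2 ^ m)%N by rewrite -expnD subnK.
by move: e; rewrite es es' e2 PoszM; lia.
Qed.

Lemma same_phase_le m n ph z ph' z' : coherent2 ph -> coherent2 ph' -> (m <= n)%N ->
  same_phase n ph z ph' z' -> same_phase m ph z ph' z'.
Proof.
by move=> [c1 c2] [c1' c2'] mn [s1 s2]; split;
  [apply: coherent_shift s1|apply: coherent_shift s2].
Qed.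

Lemma toggled_same_phase n ph z ph' z' p c :
  same_phase (level n) ph z ph' z' -> toggled ph z p n c = toggled ph' z' p n c.
Proof.
elim: p z z' => [//|[[s t] d] p IH] z z' [[u1 e1] [u2 e2]] /=; congr (_ (+) _).
  congr (_ && (_ == _)); congr pair.
    by apply: (@lab1_congr _ _ _ _ _ u1); rewrite /= /low1; case: s; lia.
  by apply: (@lab1_congr _ _ _ _ _ u2); rewrite /= /low1; case: t; lia.
apply: IH; split; rewrite /= /move1.
  by exists u1; case: s; lia.
by exists u2; case: t; lia.
Qed.

Lemma endpt_shift z p : endpt z p = (z.1 + (endpt (0, 0) p).1, z.2 + (endpt (0, 0) p).2).
Proof.
elim: p z => [|[[s t] d] p IH] z; first by case: z => a b; rewrite /= !addr0.
rewrite [LHS]/= [endpt (0, 0) _]/= IH [endpt (move (0, 0) _) _]IH /= /move1.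
by case: s; case: t => /=; congr pair; lia.
Qed.

Lemma endpt_eq_shift z z' p q : endpt z p = endpt z q -> endpt z' p = endpt z' q.
Proof.
rewrite (endpt_shift z p) (endpt_shift z q) (endpt_shift z' p) (endpt_shift z' q).
by move=> [/addrI -> /addrI ->].
Qed.

Lemma run_dark_cat_eq ph z q p p' :
  run (act := step ph) (z, dark) (q ++ p) = run (act := step ph) (z, dark) (q ++ p') <->
  endpt (endpt z q) p = endpt (endpt z q) p' /\
  (forall n c, toggled ph (endpt z q) p n c = toggled ph (endpt z q) p' n c).
Proof.
rewrite run_dark_eq !endpt_cat; split=> -[-> e]; split=> // n c.
  by have := e n c; rewrite !toggled_cat => /addbI.
by rewrite !toggled_cat e.
Qed.

(** Short words see lamps of scales at most [N] only, up to redundancy, and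
these depend only on the first [level N] digits of the shifted phases. *)
Lemma ball_iso_lamp r N ph z q ph' z' q' : coherent2 ph -> coherent2 ph' ->
  (2 * r.+1 <= side N)%N ->
  same_phase (level N) ph (endpt z q) ph' (endpt z' q') ->
  ball_iso r (Rooted (lamp_vtx ph z q)) (Rooted (lamp_vtx ph' z' q')).
Proof.
move=> coh coh' rN same.
have transfer ph1 z1 ph2 z2 p p' : coherent2 ph1 -> coherent2 ph2 ->
    same_phase (level N) ph1 z1 ph2 z2 -> (size p <= r.+1)%N -> (size p' <= r.+1)%N ->
    endpt z1 p = endpt z1 p' /\ (forall n c, toggled ph1 z1 p n c = toggled ph1 z1 p' n c) ->
    endpt z2 p = endpt z2 p' /\ (forall n c, toggled ph2 z2 p n c = toggled ph2 z2 p' n c).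
  move=> c1 c2 s sp sp' [/(endpt_eq_shift z2) -> e]; split=> //.
  have low n c : (n <= N)%N -> toggled ph2 z2 p n c = toggled ph2 z2 p' n c.
    move=> nN; have sn := same_phase_le c1 c2 (level_le nN) s.
    by rewrite -!(toggled_same_phase _ _ sn).
  move=> n c; case: (leqP n N) => nN; first exact: low.
  case: c2 => c21 c22.
  by apply: (toggled_determined c21 c22 (ltnW nN) rN sp sp') => c'; exact: low.
apply: ball_iso_orbit => p p' sp sp'; split=> /run_dark_cat_eq h; apply/run_dark_cat_eq.
  exact: transfer h.
by apply: transfer h => //; exact: same_phase_sym.
Qed.

(** Events that depend only on the phases modulo 2^m, counted from the
position of the root. *)
Definition phase_event (m : nat) (A : set rooted_graph) : Prop :=
  forall ph z q ph' z' q', coherent2 ph -> coherent2 ph' ->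
  same_phase m ph (endpt z q) ph' (endpt z' q') ->
  A (Rooted (lamp_vtx ph z q)) -> A (Rooted (lamp_vtx ph' z' q')).

Definition phase_events : set (set rooted_graph) :=
  [set A | exists m, phase_event m A].

Lemma phase_event_le m n A : (m <= n)%N -> phase_event m A -> phase_event n A.
Proof.
move=> mn hA ph z q ph' z' q' c c' s.
by apply: (hA) => //; exact: same_phase_le s.
Qed.

Lemma ball_iso_trans r g1 g2 g3 : ball_iso r g1 g2 -> ball_iso r g2 g3 -> ball_iso r g1 g3.
Proof.
move=> [f [bf rf af]] [h [bh rh ah]]; exists (h \o f); split => /=.
- exact: set_bij_comp bf bh.
- by rewrite rf.
- case: bf => ff _ _ x y bx bY; rewrite ah ?af//; exact: ff.
Qed.

(** By [ball_iso_lamp] a ball is determined by finitely many digits. *)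
Lemma local_events_phase : local_events `<=` phase_events.
Proof.
move=> _ [r [h ->]].
have [N rN] := side_unbounded (2 * r.+1).
exists (level N) => ph z q ph' z' q' c c' s /=; apply: ball_iso_trans.
by apply: (ball_iso_lamp c' c rN); exact: same_phase_sym.
Qed.

Lemma phase_events_setI : setI_closed phase_events.
Proof.
move=> A B [m hA] [n hB]; exists (maxn m n) => ph z q ph' z' q' c c' s [Ag Bg].
split.
  by apply: (phase_event_le (leq_maxl m n) hA c c' s).
by apply: (phase_event_le (leq_maxr m n) hB c c' s).
Qed.

Lemma phase_events_setT : phase_events setT.
Proof. by exists 0%N. Qed.

(** * Random phases *)

(** A 2-adic integer with the digits [b]. *)
Definition binary_value (b : nat -> bool) N : nat := (\sum_(k < N) b k * 2 ^ k)%N.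

Lemma binary_valueS b N : binary_value b N.+1 = (binary_value b N + b N * 2 ^ N)%N.
Proof. by rewrite /binary_value big_ord_recr. Qed.

Lemma binary_value_lt b N : (binary_value b N < 2 ^ N)%N.
Proof.
elim: N => [|N IH]; first by rewrite /binary_value big_ord0.
by rewrite binary_valueS expnS; case: (b N); lia.
Qed.

Lemma binary_value_coherent b : coherent (fun N => (binary_value b N)%:Z).
Proof.
move=> m n /subnK <-; elim: (n - m)%N => [|d [t et]]; first by exists 0; rewrite mul0r addr0.
exists (t + (b (d + m) * 2 ^ d)%N%:Z).
by rewrite addSn binary_valueS PoszD et expnD; lia.
Qed.

Section RandomPhases.
Context {R : realType}.

(** The digits below are only well behaved on the interval from 0 to 1, which
has full measure; other points are sent to 0. *)
Definition unit_part (x : R) : R := if 0 <= x < 1 then x else 0.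

(** A digit in base 4 consists of two binary digits, one for each
coordinate. *)
Definition digit4 (x : R) k : nat := (Num.truncn (4 ^+ k.+1 * x) %% 4)%N.

Definition phase1 (x : R) : nat -> nat := binary_value (fun k => odd (digit4 x k)).
Definition phase2 (x : R) : nat -> nat := binary_value (fun k => odd (digit4 x k)./2).

Definition random_phases (x : R) : phases :=
  (fun N => (phase1 (unit_part x) N)%:Z, fun N => (phase2 (unit_part x) N)%:Z).

Lemma random_phases_coherent x : coherent2 (random_phases x).
Proof. by split; exact: binary_value_coherent. Qed.

Lemma truncn_mul4 (y : R) : 0 <= y -> (Num.truncn (4 * y) %/ 4)%N = Num.truncn y.
Proof.
move=> y0; apply/esym/truncn_def.
have /andP[] := truncn_itv (mulr_ge0 (ler0n R 4) y0).
set t := Num.truncn _ => h1 h2.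
have l1 : (t %/ 4 * 4)%:R <= t%:R :> R by rewrite ler_nat leq_trunc_div.
have l2 : t.+1%:R <= ((t %/ 4).+1 * 4)%:R :> R by rewrite ler_nat ltn_ceil.
rewrite natrM in l1; rewrite natrM in l2; apply/andP; split; lra.
Qed.

(** Prescribing the first [N] digits in base 4 amounts to prescribing the
integer part after multiplication by 4^N, although the phases read the digits
in the opposite order. *)
Lemma phases_eq N i j : (i < 2 ^ N)%N -> (j < 2 ^ N)%N ->
  exists2 v, (v < 4 ^ N)%N & forall x : R, 0 <= x < 1 ->
    (phase1 x N = i /\ phase2 x N = j) <-> Num.truncn (4 ^+ N * x) = v.
Proof.
elim: N i j => [|N IH] i j.
  rewrite expn0 !ltnS !leqn0 => /eqP -> /eqP ->; exists 0%N => // x x01.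
  rewrite expr0 mul1r /phase1 /phase2 /binary_value !big_ord0; split=> // _.
  exact: truncn_def.
move=> iN jN; have P0 : (0 < 2 ^ N)%N by rewrite expn_gt0.
(* [b] is the leading binary digit of [a], and [l] the number formed by the others. *)
pose b (a : nat) : nat := (2 ^ N <= a)%N.
pose l a := (a - b a * 2 ^ N)%N.
have lb a : (a < 2 ^ N.+1)%N -> (l a < 2 ^ N)%N.
  by rewrite /l /b expnS; case: leqP; lia.
have [v vN hv] := IH _ _ (lb _ iN) (lb _ jN).
exists (4 * v + (b i + 2 * b j))%N.
  by rewrite expnS /b; case: leqP; case: leqP; lia.
move=> x x01; have /andP[x0 _] := x01.
have {hv} hv := hv x x01.
have split_bit a c (e : bool) : (a < 2 ^ N)%N -> (c < 2 ^ N.+1)%N ->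
    (a + e * 2 ^ N = c)%N <-> a = l c /\ e = b c :> nat.
  by rewrite expnS /l /b => aN cN; case: e; case: leqP => /= hc; split; lia.
have y0 : 0 <= 4 ^+ N * x by rewrite mulr_ge0// exprn_ge0.
have := truncn_mul4 y0; rewrite mulrA -exprS; set t := Num.truncn (4 ^+ N.+1 * x) => et.
have ed : digit4 x N = (t %% 4)%N by [].
have lt4 : (t %% 4 < 4)%N by rewrite ltn_pmod.
have bit2 d : (d < 4)%N -> d = (odd d + 2 * odd d./2)%N by case: d => [|[|[|[|]]]].
have bi : (b i <= 1)%N by rewrite leq_b1.
have bj : (b j <= 1)%N by rewrite leq_b1.
rewrite /phase1 /phase2 !binary_valueS -/(phase1 x) -/(phase2 x) ed.
rewrite !split_bit ?binary_value_lt//.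
have := divn_eq t 4; have := bit2 _ lt4; rewrite et.
move: (odd (t %% 4)) (odd (t %% 4)./2) => o1 o2 e2 e1.
split=> [[[h1 h2] [h3 h4]]|h].
  by have := hv.1 (conj h1 h3); lia.
have tv : Num.truncn (4 ^+ N * x) = v by lia.
have [h1 h3] := hv.2 tv.
have o12 : (o1 + 2 * o2 = b i + 2 * b j)%N by lia.
by split; split=> //; case: o1 o2 o12 {e2 e1} => -[]; lia.
Qed.

Definition unit_prob : set (measurableTypeR R) -> \bar R :=
  mrestr (@lebesgue_measure R) (measurable_itv (Interval (BLeft 0) (BLeft 1))).

HB.instance Definition _ := Measure.copy unit_prob
  (mrestr (@lebesgue_measure R) (measurable_itv (Interval (BLeft 0) (BLeft 1)))).

Lemma unit_probT : unit_prob setT = 1%E.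
Proof.
by rewrite /unit_prob /mrestr setTI lebesgue_measure_itv /= lte_fin ltr01 sube0.
Qed.

HB.instance Definition _ := Measure_isProbability.Build _ _ _ unit_prob unit_probT.

Definition phase_cell N (i j : nat) : set (measurableTypeR R) :=
  [set x | phase1 (unit_part x) N = i /\ phase2 (unit_part x) N = j].

(** The cell is an interval of length 4^-N, up to points outside the unit interval. *)
Lemma phase_cellE N i j : (i < 2 ^ N)%N -> (j < 2 ^ N)%N ->
  measurable (phase_cell N i j) /\ unit_prob (phase_cell N i j) = (4^-1 ^+ N)%:E.
Proof.
move=> iN jN; have [v vN hv] := phases_eq iN jN.
have p0 : 0 < 4 ^+ N :> R by rewrite exprn_gt0.
pose I : set R := `[v%:R / 4 ^+ N, v.+1%:R / 4 ^+ N[%classic.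
pose U : set R := `[0, 1[%classic.
have inI x : U x -> phase_cell N i j x <-> I x.
  rewrite /U /= in_itv /= => x01; rewrite /phase_cell /= /unit_part x01 (hv _ x01).
  rewrite /I /= in_itv /= ler_pdivrMr// ltr_pdivlMr// ![x * _]mulrC.
  have y0 : 0 <= 4 ^+ N * x by case/andP: x01 => x0 _; rewrite mulr_ge0// ltW.
  by split=> [<-|/truncn_def//]; exact: truncn_itv.
have IU : I `<=` U.
  move=> x; rewrite /I /U /= !in_itv /= => /andP[h1 h2]; apply/andP; split.
    by apply: le_trans h1; rewrite divr_ge0// ltW.
  by apply: lt_le_trans h2 _; rewrite ler_pdivrMr// mul1r -natrX ler_nat.
have outU x : ~ U x -> phase_cell N i j x <-> phase_cell N i j (-1).
  rewrite /U /= in_itv /= => /negP/negbTE x01; rewrite /phase_cell /= /unit_part x01.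
  by rewrite ler0N1.
have cellE : phase_cell N i j `&` U = I.
  apply/seteqP; split=> [x [h1 h2]|x h]; first exact/inI.
  by split; [apply/inI => //; exact: IU|exact: IU].
split.
  have -> : phase_cell N i j = I `|` ((~` U) `&` [set x | phase_cell N i j (-1)]).
    apply/seteqP; split=> x.
      case: (pselect (U x)) => Ux h; first by left; apply/inI.
      by right; split=> //=; apply/(outU x).
    by move=> [h|[Ux h]]; [apply/inI => //; exact: IU|apply/(outU x)].
  apply: measurableU; first exact: measurable_itv.
  apply: measurableI; first by apply: measurableC; exact: measurable_itv.
  case: (pselect (phase_cell N i j (-1))) => h.
    by rewrite (_ : [set _ | _] = setT)//; apply/seteqP; split.
  by rewrite (_ : [set _ | _] = set0)//; apply/seteqP; split.
rewrite /unit_prob /mrestr cellE lebesgue_measure_itv /= lte_fin.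
rewrite ltr_pM2r ?invr_gt0// ltr_nat ltnSn -EFinB -mulrBl -natrB// subSnn mul1r.
by rewrite exprVn.
Qed.

End RandomPhases.

(** * Stationarity *)

Section Residues.
Variable M : nat.
Hypothesis M_gt0 : (0 < M)%N.

Definition rotate (e : int) (i : nat) : nat := `|((i%:Z + e) %% M)%Z|%N.

Lemma rotateE e i : (rotate e i)%:Z = ((i%:Z + e) %% M)%Z.
Proof. by rewrite /rotate gez0_abs// modz_ge0//; lia. Qed.

Lemma rotate_lt e i : (rotate e i < M)%N.
Proof. by rewrite -ltz_nat rotateE ltz_pmod//; lia. Qed.

Lemma rotate_mod e i : exists t : int, i%:Z + e = (rotate e i)%:Z + t * M.
Proof.
by exists ((i%:Z + e) %/ M)%Z; rewrite rotateE [RHS]addrC; exact: divz_eq.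
Qed.

Lemma rotateK e i : (i < M)%N -> rotate (- e) (rotate e i) = i.
Proof.
move=> iM; apply: (can_inj absz_nat) => /=.
by rewrite rotateE rotateE modzDml addrK modz_small//; lia.
Qed.
End Residues.

Section Law.
Context {R : realType}.
Notation T := (measurableTypeR R).
Notation P := (@unit_prob R).

(** The rooted graphs with the sigma-algebra generated by [phase_events],
which is finer than that of [rooted_space]; the uniqueness of measures is
applied here because [phase_events] is closed under intersection. *)
Definition phase_space := g_sigma_algebraType phase_events.
HB.instance Definition _ := Measurable.on phase_space.

Definition rooted_at (q : seq dir) (x : T) : rooted_graph :=
  Rooted (lamp_vtx (random_phases x) (0, 0) q).

Definition const_phases (ij : nat * nat) : phases := (fun _ => ij.1%:Z, fun _ => ij.2%:Z).

Lemma const_phases_coherent ij : coherent2 (const_phases ij).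
Proof. by split=> m n _; exists 0; rewrite mul0r addr0. Qed.

(** Constant phases serve as representatives of the residues modulo 2^m. *)
Definition good_cells m (A : set rooted_graph) q : set (nat * nat) :=
  [set ij | [/\ (ij.1 < 2 ^ m)%N, (ij.2 < 2 ^ m)%N &
                A (Rooted (lamp_vtx (const_phases ij) (0, 0) q))]].

Lemma finite_good_cells m A q : finite_set (good_cells m A q).
Proof.
apply: (@sub_finite_set _ _ ([set i | (i < 2 ^ m)%N] `*` [set j | (j < 2 ^ m)%N])).
  by move=> [i j] [h1 h2 _].
by apply: finite_setX; exact: finite_II.
Qed.

Lemma preimage_rooted_at m A q : phase_event m A ->
  rooted_at q @^-1` A = \bigcup_(ij in good_cells m A q) phase_cell m ij.1 ij.2.
Proof.
move=> hA.
have same x ij : phase_cell m ij.1 ij.2 x ->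
    same_phase m (random_phases x) (endpt (0, 0) q) (const_phases ij) (endpt (0, 0) q).
  by case: ij => i j [/= <- <-]; split; exists 0; rewrite mul0r addr0.
apply/seteqP; split=> x.
  move=> Ax; exists (phase1 (unit_part x) m, phase2 (unit_part x) m) => //.
  split; rewrite ?binary_value_lt//.
  by apply: hA Ax; [exact: random_phases_coherent|exact: const_phases_coherent|exact: same].
move=> [ij [_ _ Aij] cij]; rewrite /preimage /=.
apply: hA Aij; [exact: const_phases_coherent|exact: random_phases_coherent|].
by apply: same_phase_sym; exact: same.
Qed.

(** Translating the root rotates the residues. *)
Lemma good_cells_bij m A q : phase_event m A ->
  set_bij (good_cells m A q) (good_cells m A [::])
    (fun ij => (rotate (2 ^ m) (endpt (0, 0) q).1 ij.1, rotate (2 ^ m) (endpt (0, 0) q).2 ij.2)).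
Proof.
move=> hA; have M0 : (0 < 2 ^ m)%N by rewrite expn_gt0.
set e := endpt (0, 0) q.
have same i j : same_phase m (const_phases (i, j)) e
    (const_phases (rotate (2 ^ m) e.1 i, rotate (2 ^ m) e.2 j)) (0, 0).
  have [t et] := rotate_mod M0 e.1 i; have [t' et'] := rotate_mod M0 e.2 j.
  by split; [exists t|exists t']; rewrite /= addr0.
split.
- move=> [i j] [_ _ Aij]; split; rewrite /= ?rotate_lt//.
  apply: hA Aij; [exact: const_phases_coherent|exact: const_phases_coherent|exact: same].
- move=> [i j] [i' j'] /set_mem[/= iM jM _] /set_mem[/= iM' jM' _] [e1 e2].
  rewrite -(rotateK M0 e.1 iM) -(rotateK M0 e.2 jM) e1 e2.
  by rewrite !rotateK.
- move=> [i j] [/= iM jM Aij].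
  have back1 : rotate (2 ^ m) e.1 (rotate (2 ^ m) (- e.1) i) = i.
    by rewrite -{1}(opprK e.1) rotateK.
  have back2 : rotate (2 ^ m) e.2 (rotate (2 ^ m) (- e.2) j) = j.
    by rewrite -{1}(opprK e.2) rotateK.
  exists (rotate (2 ^ m) (- e.1) i, rotate (2 ^ m) (- e.2) j); last by rewrite /= back1 back2.
  split; rewrite /= ?rotate_lt//.
  apply: hA Aij; [exact: const_phases_coherent|exact: const_phases_coherent|].
  apply: same_phase_sym; rewrite -{2}back1 -{2}back2; exact: same.
Qed.

(** All the cells have the same measure, and moving the root permutes them. *)
Lemma phase_event_law m A q : phase_event m A ->
  measurable (rooted_at q @^-1` A) /\ P (rooted_at q @^-1` A) = P (rooted_at [::] @^-1` A).
Proof.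
move=> hA; have cells p ij : good_cells m A p ij -> measurable (phase_cell m ij.1 ij.2 : set T) /\
    P (phase_cell m ij.1 ij.2) = (4^-1 ^+ m)%:E.
  by move=> [h1 h2 _]; exact: phase_cellE.
have mes p : measurable (rooted_at p @^-1` A).
  rewrite (preimage_rooted_at _ hA); apply: fin_bigcup_measurable.
    exact: finite_good_cells.
  by move=> ij /cells[].
split; first exact: mes.
pose c : \bar R := ((4^-1 : R) ^+ m)%:E.
have law p : P (rooted_at p @^-1` A) = (\sum_(ij \in good_cells m A p) c)%E.
  rewrite (preimage_rooted_at _ hA) measure_fin_bigcup//=.
  - by apply: eq_fsbigr => ij /set_mem/cells[].
  - exact: finite_good_cells.
  - move=> [i j] [i' j'] _ _ [x [[e1 e2] [e3 e4]]].
    by move: e1 e2 e3 e4 => /= <- <- <- <-.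
  - by move=> ij /cells[].
by rewrite !law (reindex_fsbig _ _ _ _ (good_cells_bij q hA)).
Qed.

Lemma rooted_at_measurable q : measurable_fun [set: T] (rooted_at q : T -> phase_space).
Proof.
apply: (@measurability _ _ T phase_space setT _ phase_events) => //.
move=> _ [A [m hA] <-]; rewrite setTI.
by have [] := phase_event_law q hA.
Qed.

Lemma measurable_rooted_phase (A : set rooted_graph) :
  measurable (A : set rooted_space) -> measurable (A : set phase_space).
Proof. by apply: sub_sigma_algebra2; exact: local_events_phase. Qed.

(** The law of the graph does not depend on the root, by uniqueness of
measures on a pi-system. *)
Lemma rooted_at_law q (A : set rooted_space) : measurable A ->
  measurable (rooted_at q @^-1` A) /\ P (rooted_at q @^-1` A) = P (rooted_at [::] @^-1` A).
Proof.
move=> mA; have mA' := measurable_rooted_phase mA.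
split.
  by have := rooted_at_measurable q measurableT mA'; rewrite setTI.
pose mu p : measure phase_space R :=
  measure_function_pushforward__canonical__measure_function_Measure P (rooted_at_measurable p).
apply: (@measure_unique _ R phase_space phase_events (fun=> setT) erefl
  phase_events_setI _ _ (mu q) (mu [::]) _ _ A mA').
- by move=> _; exact: phase_events_setT.
- by apply/seteqP; split=> // x _; exists 0%N.
- by move=> B [m hB]; have [_ ] := phase_event_law q hB.
- by move=> _; rewrite /mu /= /pushforward preimage_setT probability_setT ltry.
Qed.

Lemma rooted_at_random : random_rooted_graph P (rooted_at [::] : T -> rooted_space).
Proof.
split; first by move=> _ A mA; rewrite setTI; have [] := rooted_at_law [::] mA.
by apply: aeW => x; exact: orbit_graph_connected.
Qed.

Lemma law_at_rooted n (A : set rooted_space) :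
  law_at P (rooted_at [::] : T -> rooted_space) n A =
  (\int[P]_x (wexp n (fun p => \1_A (rooted_at p x : rooted_space)))%:E)%E.
Proof.
rewrite /law_at; apply: eq_integral => x _.
by rewrite srw_expect_vtx ?card_dir//; exact: step_inj.
Qed.

(** The law of the graph seen after one step is an average of laws of the
graph rooted at a neighbour, all equal by [rooted_at_law]. *)
Lemma rooted_at_stationary : stationary P (rooted_at [::] : T -> rooted_space).
Proof.
move=> A mA; rewrite !law_at_rooted.
have mpre q := (rooted_at_law q mA).1.
pose h q (x : T) : \bar R := (\1_(rooted_at q @^-1` A) x)%:E.
have mh q : measurable_fun [set: T] (h q : T -> \bar R).
  by apply/measurable_EFinP; exact: measurable_indic.
have h0 q x : (0 <= h q x)%E by rewrite lee_fin.
have int_h q : (\int[P]_x h q x)%E = P (rooted_at [::] @^-1` A).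
  by rewrite -(rooted_at_law q mA).2 /h integral_indic// setIT.
have -> : (\int[P]_x (wexp 0 (fun p => \1_A (rooted_at p x : rooted_space)))%:E)%E =
    P (rooted_at [::] @^-1` A) by exact: int_h.
have -> : (\int[P]_x (wexp 1 (fun p => \1_A (rooted_at p x : rooted_space)))%:E)%E =
    (\int[P]_x ((8^-1)%:E * \sum_(g : dir) h [:: g] x))%E.
  by apply: eq_integral => x _; rewrite wexpS card_dir EFinM sumEFin.
rewrite ge0_integralZl_EFin//; last 2 first.
- by move=> x _; apply: sume_ge0 => g _; exact: h0.
- by apply: emeasurable_sum => g; exact: mh.
rewrite ge0_integral_sum//; under eq_bigr do rewrite int_h.
have -> : P (rooted_at [::] @^-1` A) = (fine (P (rooted_at [::] @^-1` A)))%:E.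
  by rewrite fineK// fin_num_measure.
rewrite sumEFin -EFinM sumr_const card_dir -[fine _ *+ _]mulr_natl mulKf// pnatr_eq0.
Qed.

Lemma rooted_at_growth : as_polynomial_growth P (rooted_at [::] : T -> rooted_space).
Proof.
exists (9 * 2 ^+ 12), 10; split=> //.
apply: aeW => w x r r1.
have r0 : 0 <= r by apply: le_trans r1.
have k0 : (0 < Num.truncn r)%N by rewrite truncn_gt0.
have [c1 c2] := random_phases_coherent w.
have le_k (m : nat) : m%:R <= r -> (m <= Num.truncn r)%N by rewrite truncn_ge_nat.
have := @gball_lamp_growth (random_phases w) (0, 0) c1 c2 R x r (Num.truncn r) k0 le_k.
rewrite -(ler_nat R) => /le_trans; apply.
rewrite natrM natrM !natrX powR_mulrn//; apply: ler_wpM2l.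
  by rewrite mulr_ge0// exprn_ge0.
by apply: lerXn2r; rewrite ?nnegrE// truncn_le.
Qed.

End Law.

(** * Choice of the times *)

(** Arranged so that [(label_exp (scale_index n)).+2 = 10 * (n + 22)]: the
bound 4^(10 j) on the logarithm of the time becomes 4^(9 j) when raised to the
power 9/10. The shift by 22 is what makes the exponential win in
[pow2_beats_linear]. *)
Definition scale_index (n : nat) : nat := (10 * (n + 22) - 3)%N.

Lemma walk_time_mono : {homo walk_time : m n / (m < n)%N}.
Proof.
move=> m n mn; rewrite /walk_time ltn_exp2l// /level -addnS leq_add//.
by rewrite side_exp_le// ltnW.
Qed.

Lemma pow2_beats_linear n : (3564 * 10 * (n + 22) <= 2 ^ (n + 20))%N.
Proof.
have e10 : (2 ^ 10 = 1024)%N by [].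
elim: n => [|n IH]; last by rewrite (addSn n 20) expnS; lia.
by rewrite (expnD 2 10 10) e10; lia.
Qed.

Section FinalBound.
Context {R : realType}.

Lemma ln_walk_time_le n : ln (walk_time n)%:R <= 4 ^+ (label_exp n).+2 :> R.
Proof.
rewrite /walk_time natrX lnXn// -[ln _ *+ _]mulr_natl.
have l4 : ln (4 : R) <= 4 by apply/ltW/ln_sublinear.
apply: (@le_trans _ _ ((level n)%:R * 4)); first by rewrite ler_wpM2l.
have -> : level n = (4 ^ label_exp n + label_exp n)%N by [].
move: (label_exp n) => k; have : k%:R <= 4 ^+ k :> R.
  by rewrite -natrX ler_nat ltnW// ltn_expl.
by have := ler0n R k; rewrite natrD natrX !exprS; lra.
Qed.

Lemma label_exp_le_pow4 n : let k := label_exp (scale_index n) in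
  1782 * k%:R <= 4 ^+ k :> R.
Proof.
cbv zeta; set k := label_exp _.
have ek : k = (10 * (n + 22) - 2)%N by rewrite /k /label_exp /scale_index; lia.
rewrite -natrX -natrM ler_nat; apply: (@leq_trans (2 ^ (n + 20))%N).
  by apply: leq_trans (pow2_beats_linear n); rewrite ek; lia.
apply: (@leq_trans (2 ^ k)%N); first by rewrite leq_exp2l// ek; lia.
by rewrite leq_exp2r// ek; lia.
Qed.

(** Let k be the label exponent, j = n + 22 and w = 2^(n + 20), so that
4^k = 4^(9 j) w^2. The time is [side]^2 4^k and the power of its logarithm is at
most 4^(9 j), so the left-hand side is at most ([side] * 4^(9 j) * w)^2. On the
right, 4^k / (1782 k) >= 2 * 4^(9 j) * w since 3564 k <= w, and the second copy
of 4^(9 j) * w absorbs the subtracted 1. *)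
Lemma time_log_le_sq n : let k := label_exp (scale_index n) in
  (walk_time (scale_index n))%:R * ln (walk_time (scale_index n))%:R `^ (9%:R / 10%:R) <=
  ((side (scale_index n))%:R * (4 ^+ k / (1782 * k%:R) - 1)) ^+ 2 :> R.
Proof.
set s := scale_index n; pose j := (n + 22)%N.
have ek : label_exp s = (10 * j - 2)%N by rewrite /s /scale_index /label_exp -/j /j; lia.
cbv zeta; set k := label_exp s.
have ek2 : (k.+2 = 10 * j)%N by rewrite /k ek /j; lia.
have ekj : (k = 9 * j + (n + 20))%N by rewrite /k ek /j; lia.
have log_le : ln (walk_time s)%:R `^ (9%:R / 10%:R) <= 4 ^+ (9 * j) :> R.
  have base : ln (walk_time s)%:R <= 4 ^+ (10 * j) :> R.
    by rewrite -ek2; exact: ln_walk_time_le.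
  have ln0 : 0 <= ln (walk_time s)%:R :> R.
    by rewrite ln_ge0// ler1n expn_gt0.
  have p4 : 0 <= (4 : R) by [].
  apply: le_trans (ge0_ler_powR _ _ _ base) _; rewrite ?nnegrE ?exprn_ge0 ?divr_ge0//.
  rewrite -!powR_mulrn// -powRrM natrM [10%:R * _]mulrC.
  by rewrite (_ : j%:R * 10%:R * (9%:R / 10%:R) = (9 * j)%:R) ?powR_mulrn// natrM; lra.
apply: le_trans (ler_wpM2l (ler0n _ _) log_le) _.
have size_le : 3564 * k%:R <= 2 ^+ (n + 20) :> R.
  rewrite -natrX -natrM ler_nat; apply: leq_trans (pow2_beats_linear n).
  by rewrite -mulnA leq_mul2l; apply/orP; right; rewrite /k ek /j; lia.
have k0 : 0 < k%:R :> R by rewrite ltr0n /k ek /j; lia.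
set X : R := 4 ^+ k / (1782 * k%:R).
pose w : R := 2 ^+ (n + 20).
rewrite -/w in size_le.
have w0 : 1 <= w by rewrite exprn_ege1// ler1n.
have e4 : 4 ^+ k = 4 ^+ (9 * j) * w ^+ 2 :> R.
  rewrite ekj exprD /w -exprM [((n + 20) * 2)%N]mulnC (exprM 2 2).
  by congr (_ * (_ ^+ _)); lra.
have p9 : 1 <= 4 ^+ (9 * j) :> R by rewrite exprn_ege1// ler1n.
have D0 : 0 < 1782 * k%:R :> R by lra.
have X2 : 4 ^+ (9 * j) * (2 * w) <= X.
  have := ler_wpM2l (le_trans ler01 w0) size_le => h.
  by rewrite /X ler_pdivlMr// e4 -mulrA ler_wpM2l//; first lra; rewrite expr2; lra.
have aw : 1 <= 4 ^+ (9 * j) * w by rewrite mulr_ege1.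
have X1 : 4 ^+ (9 * j) * w <= X - 1 by lra.
have aw0 : 0 <= 4 ^+ (9 * j) * w := le_trans ler01 aw.
have L2 : (walk_time s)%:R = (side s)%:R ^+ 2 * (4 ^+ (9 * j) * w ^+ 2) :> R.
  rewrite /walk_time natrX /level exprD -/k e4; congr (_ * _).
  by rewrite /side natrX -exprM mulnC exprM; congr (_ ^+ _); lra.
rewrite L2 exprMn -mulrA ler_wpM2l ?exprn_ge0//.
apply: (@le_trans _ _ ((4 ^+ (9 * j) * w) ^+ 2)).
  by rewrite exprMn mulrAC -expr2.
by rewrite ler_pXn2r// nnegrE// (le_trans aw0 X1).
Qed.

End FinalBound.

Theorem theorem1p5 (R : realType) :
  exists (d : measure_display) (T : measurableType d) (P : probability T R)
         (G : T -> rooted_space) (t : nat -> nat),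
    [/\ random_rooted_graph P G,
        stationary P G,
        as_polynomial_growth P G,
        (forall n, (0 < t n)%N) /\ {homo t : m n / (m < n)%N}
      & P [set w | (t n)%:R * (ln (t n)%:R) `^ (9%:R / 10%:R)
                     <= mean_sq_displacement R G (t n) w]
          @[n --> \oo] --> 1%E].
Proof.
exists _, (measurableTypeR R), (@unit_prob R), (rooted_at [::]),
  (fun n => walk_time (scale_index n)); split.
- exact: rooted_at_random.
- exact: rooted_at_stationary.
- exact: rooted_at_growth.
- split=> [n|m n mn]; first by rewrite expn_gt0.
  by apply: walk_time_mono; rewrite /scale_index; lia.
- rewrite (_ : (fun n => _) = fun=> 1%E); first exact: cvg_cst.
  apply/funext => n; rewrite -[RHS](probability_setT (@unit_prob R)).
  congr (unit_prob _); apply/seteqP; split=> // x _ /=.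
  apply: le_trans (time_log_le_sq n) _.
  apply: (@mean_sq_displacement_ge R (random_phases x) (scale_index n) (0, 0)).
  exact: label_exp_le_pow4.
Qed.
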